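(* Let $d=\Theta(\log n)$ and $k=\Theta(\sqrt{\log n})$. There is a (randomized) data structure for the online approximate dynamic distance estimation problem supporting: (1) Init$(\{x_1,\dots,x_n\}\subset\mathbb{R}^d,n,d,\epsilon\in(0,1))$: given $n$ data points, preprocess in time $O(ndk)$; (2) Update$(z\in\mathbb{R}^d,i\in[n])$: replace the $i$-th data point by $z$, in time $O(dk)$; (3) Query$(q\in\mathbb{R}^d)$: in time $O(nk)$, output $u\in\mathbb{R}^n$ such that for all $i\in[n]$, $$\|q-x_i\|_2\le u_i\le n^{O(1/k)}\cdot\|q-x_i\|_2,$$ with probability at least $1-1/\mathrm{poly}(n)$, even for a sequence of adversarially chosen queries.
   Context: Here $x_1,\dots,x_n$ denote the current data points (after all updates so far). ''Adversarially chosen queries'' means the query points may be chosen adaptively, depending on previous outputs of the data structure. *)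

(* Defs.v *)
From HB Require Import structures.
From mathcomp Require Import all_boot all_order all_algebra.
From mathcomp Require Import all_classical all_reals all_analysis.
Import Order.TTheory GRing.Theory Num.Theory numFieldNormedType.Exports.

Set Implicit Arguments.
Unset Strict Implicit.
Unset Printing Implicit Defensive.

Local Open Scope classical_set_scope.
Local Open Scope ring_scope.

(* Real RAM with unit-cost instructions.  A program is a finite piece of
   syntax, independent of the input size.  It works on index registers (naturals,
   with truncated subtraction and no multiplication), real registers (exact
   real arithmetic, no rounding to naturals), and two-dimensional arrays of
   reals whose cells are addressed by two index registers.  Registers and arrays
   are named by natural number literals; the only real constants are naturals. *)
Inductive test :=
| IdxLt of nat & nat
| RealLt of nat & nat.

Inductive instr :=
| IdxConst (dst c : nat)
| IdxAdd (dst x y : nat)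
| IdxSub (dst x y : nat)
| RealConst (dst c : nat)
| RealOfIdx (dst x : nat)
| RealAdd (dst x y : nat)
| RealSub (dst x y : nat)
| RealMul (dst x y : nat)
| RealDiv (dst x y : nat)
| RealSqrt (dst x : nat)
| ReadCell (dst arr row col : nat)
| WriteCell (arr row col src : nat)
| Random (dst : nat)
| If of test & seq instr & seq instr
| While of test & seq instr.

Definition program := seq instr.

Definition upd (A : Type) (f : nat -> A) (x : nat) (v : A) : nat -> A :=
  fun y => if y == x then v else f y.

(* [coins] is the number of random reals drawn so far. *)
Record state (R : realType) := State {
  idx : nat -> nat;
  reals : nat -> R;
  arrays : nat -> nat -> nat -> R;
  coins : nat }.

Section Execution.
Context {R : realType}.

Definition eval_test (s : state R) (b : test) : bool :=
  match b with
  | IdxLt x y => (idx s x < idx s y)%N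
  | RealLt x y => reals s x < reals s y
  end.

Definition set_idx (s : state R) (x v : nat) : state R :=
  State (upd (idx s) x v) (reals s) (arrays s) (coins s).

Definition set_real (s : state R) (x : nat) (v : R) : state R :=
  State (idx s) (upd (reals s) x v) (arrays s) (coins s).

Definition set_array (s : state R) (a : nat) (f : nat -> nat -> R) : state R :=
  State (idx s) (reals s) (upd (arrays s) a f) (coins s).

Definition set_cell (s : state R) (a i j : nat) (v : R) : state R :=
  set_array s a (upd (arrays s a) i (upd (arrays s a i) j v)).

(* One machine step: the code still to be executed is kept as a list.  Drawing
   the t-th random real reads [tape t]; the tape will be i.i.d. uniform on
   [0, 1]. *)
Definition step (tape : nat -> R) (cfg : program * state R) :
    program * state R :=
  let: (p, s) := cfg in
  match p with
  | [::] => (p, s)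
  | IdxConst x c :: p' => (p', set_idx s x c)
  | IdxAdd x y z :: p' => (p', set_idx s x (idx s y + idx s z)%N)
  | IdxSub x y z :: p' => (p', set_idx s x (idx s y - idx s z)%N)
  | RealConst x c :: p' => (p', set_real s x c%:R)
  | RealOfIdx x y :: p' => (p', set_real s x (idx s y)%:R)
  | RealAdd x y z :: p' => (p', set_real s x (reals s y + reals s z))
  | RealSub x y z :: p' => (p', set_real s x (reals s y - reals s z))
  | RealMul x y z :: p' => (p', set_real s x (reals s y * reals s z))
  | RealDiv x y z :: p' => (p', set_real s x (reals s y / reals s z))
  | RealSqrt x y :: p' => (p', set_real s x (Num.sqrt (reals s y)))
  | ReadCell x a i j :: p' => (p', set_real s x (arrays s a (idx s i) (idx s j)))
  | WriteCell a i j x :: p' => (p', set_cell s a (idx s i) (idx s j) (reals s x))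
  | Random x :: p' =>
      let s' := set_real s x (tape (coins s)) in
      (p', State (idx s') (reals s') (arrays s') (coins s).+1)
  | If b p1 p2 :: p' => ((if eval_test s b then p1 else p2) ++ p', s)
  | While b p1 :: p' => (if eval_test s b then p1 ++ p else p', s)
  end.

Definition run (tape : nat -> R) (t : nat) (p : program) (s : state R) :
    program * state R :=
  iter t (step tape) (p, s).

(* As [step] is the identity on empty code, this says that the program
   terminated after at most the [t] steps given to [run]. *)
Definition halted (cfg : program * state R) : bool := nilp cfg.1.

Definition write_mx m p (A : 'M[R]_(m, p)) (f : nat -> nat -> R) :
    nat -> nat -> R :=
  fun i j => if (insub i, insub j) is (Some i', Some j') then A i' j' else f i j.

End Execution.

Record data_structure := DataStructure {
  init : program;
  update : program;
  query : program }.

(* Calling conventions.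
   - Init: index registers 0 and 1 hold n and d, real register 0 holds epsilon,
     array 0 holds the n points as rows; everything else is zero.
   - Update: index register 2 holds i, row 0 of array 1 holds z.
   - Query: row 0 of array 1 holds q; the answer is read off row 0 of array 2.
   All registers and arrays persist from one operation to the next. *)
Section Interface.
Context {R : realType} {n d : nat}.

Definition init_state (X : 'M[R]_(n, d)) (eps : R) : state R :=
  State (upd (upd (fun=> 0%N) 0 n) 1 d)
        (upd (fun=> 0) 0 eps)
        (upd (fun _ _ _ => 0) 0 (write_mx X (fun _ _ => 0))) 0.

Definition pass_vector (s : state R) (v : 'rV[R]_d) : state R :=
  set_array s 1 (write_mx v (arrays s 1)).

Definition update_state (s : state R) (z : 'rV[R]_d) (i : 'I_n) : state R :=
  pass_vector (set_idx s 2 i) z.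

Definition output (s : state R) : 'rV[R]_n := \row_i arrays s 2 0 i.

Definition replace_point (X : 'M[R]_(n, d)) (z : 'rV[R]_d) (i : 'I_n) :
    'M[R]_(n, d) :=
  \matrix_(l, j) if l == i then z 0 j else X l j.

(* The updates are fixed in advance; the query points are not part of the
   schedule, since the adversary chooses them on the fly. *)
Inductive request :=
| Update of 'rV[R]_d & 'I_n
| Query.

Definition is_update (r : request) : bool := if r is Update _ _ then true else false.

(* What is observed when a request is served: whether the program met its time
   budget and, for a query, the current points, the query and the answer. *)
Inductive reply :=
| UpdateReply (in_time : bool)
| QueryReply (in_time : bool) (X : 'M[R]_(n, d)) (q : 'rV[R]_d) (u : 'rV[R]_n).

Definition served_in_time (r : reply) : bool :=
  match r with UpdateReply b => b | QueryReply b _ _ _ => b end.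

(* The adversary computes its next query from all previous answers [hist];
   [tU] and [tQ] are the time budgets of an update and of a query. *)
Fixpoint serve (D : data_structure) (tU tQ : nat) (tape : nat -> R)
    (adversary : seq 'rV[R]_n -> 'rV[R]_d) (reqs : seq request)
    (s : state R) (X : 'M[R]_(n, d)) (hist : seq 'rV[R]_n) : seq reply :=
  match reqs with
  | [::] => [::]
  | Update z i :: reqs' =>
      let r := run tape tU (update D) (update_state s z i) in
      UpdateReply (halted r)
      :: serve D tU tQ tape adversary reqs' r.2 (replace_point X z i) hist
  | Query :: reqs' =>
      let q := adversary hist in
      let r := run tape tQ (query D) (pass_vector s q) in
      let u := output r.2 in
      QueryReply (halted r) X q u
      :: serve D tU tQ tape adversary reqs' r.2 X (rcons hist u)
  end.

Definition l2norm (v : 'rV[R]_d) : R := Num.sqrt (\sum_j v 0 j ^+ 2).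

Definition accurate (alpha : R) (r : reply) : Prop :=
  if r is QueryReply _ X q u then
    forall i, l2norm (q - row i X) <= u 0 i <= alpha * l2norm (q - row i X)
  else True.

End Interface.

Arguments request : clear implicits.
Arguments reply : clear implicits.

Section Probability.
Context {disp : measure_display} {T : measurableType disp} {R : realType}
  (P : probability T R).

Definition iid_uniform01 (U : nat -> {RV P >-> R}) : Prop :=
  (forall i (A : set R), measurable A ->
     P (U i @^-1` A) = uniform_prob (@ltr01 R) A) /\
  (forall (J : seq nat) (A : nat -> set R), uniq J ->
     (forall i, measurable (A i)) ->
     P (\bigcap_(i in [set` J]) (U i @^-1` A i)) =
     (\prod_(i <- J) P (U i @^-1` A i))%E).

(* The event need not be measurable, because the adversary is an arbitrary
   function; it has to contain a measurable event of the required probability. *)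
Definition prob_at_least (p : R) (event : T -> Prop) : Prop :=
  exists E : set T,
    [/\ measurable E, (p%:E <= P E)%E & forall w, E w -> event w].

End Probability.

(* Main.v *)
(** Each point is sketched by K random linear forms with coefficients uniform in
    [0, 1], where K is the least number with n <= 2 ^ (K ^ 2); put W = B ^ K for
    a large constant B.  A fixed vector v satisfies |v| <= W * sketch_norm v
    outside an event of probability (O(d) / W) ^ K = n ^ (- O(1)), so with high
    probability this holds for all differences of data points; on the other hand
    sketch_norm v <= K * d * |v| for every v.  No such lower bound can hold for
    the differences q - x_i, as q is adversarial and K < d.  A query therefore
    uses sketches only to find the data point x_b whose sketch is nearest to that
    of q, computes r = |q - x_b| exactly, and answers
    u_i = r + W * sketch_norm (x_b - x_i).  This is at least |q - x_i| by the
    triangle inequality; and sketch_norm (x_b - x_i) <= 2 * sketch_norm (q - x_i)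
    by the choice of b, whence u_i <= (1 + 4 * K * d * W) * |q - x_i|.  Once the
    differences of data points are good, no query can fail. *)

Require Import Defs.
From mathcomp Require Import all_boot all_order all_algebra.
From mathcomp Require Import all_classical all_reals all_analysis.
From mathcomp Require Import zify ring lra.
Import Order.TTheory GRing.Theory Num.Theory numFieldNormedType.Exports.

Set Implicit Arguments.
Unset Strict Implicit.
Unset Printing Implicit Defensive.

Local Open Scope classical_set_scope.
Local Open Scope ring_scope.

(** * Timed Hoare triples *)

Section TimedTriples.
Context {R : realType} (tape : nat -> R).
Implicit Types (s : state R) (p : program) (Q : state R -> Prop).

(** The continuation [rest] is universally quantified because [step] keeps pending code as a list: a
    triple for [p] then applies inside any larger program, and costs add under concatenation. *)
Definition wp (t : nat) p s Q : Prop :=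
  exists t' s', [/\ (t' <= t)%N,
    forall rest, iter t' (step tape) (p ++ rest, s) = (rest, s') & Q s'].

Lemma wp_run t p s Q : wp t p s Q ->
  halted (run tape t p s) /\ Q (run tape t p s).2.
Proof.
move=> [t' [s' [tt' H HQ]]]; rewrite /run -(subnK tt') iterD.
have := H [::]; rewrite cats0 => ->.
by elim: (t - t')%N => //= m [h1 h2]; rewrite /halted; case: (iter _ _ _) h1 h2 => [[|? ?]].
Qed.

Lemma wp_weaken t u p s Q : (t <= u)%N -> wp t p s Q -> wp u p s Q.
Proof. by move=> tu [t' [s' [h1 h2 h3]]]; exists t', s'; split=> //; exact: leq_trans tu. Qed.

Lemma wp_mono t p s Q Q' : wp t p s Q -> (forall s', Q s' -> Q' s') -> wp t p s Q'.
Proof. by move=> [t' [s' [h1 h2 h3]]] QQ; exists t', s'; split=> //; exact: QQ. Qed.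

Lemma wp_nil t s Q : Q s -> wp t [::] s Q.
Proof. by move=> Qs; exists 0%N, s; split. Qed.

Lemma wp_step t ins p s s1 Q :
  (forall p', step tape (ins :: p', s) = (p', s1)) -> wp t p s1 Q ->
  wp t.+1 (ins :: p) s Q.
Proof.
move=> H [t' [s' [h1 h2 h3]]]; exists t'.+1, s'; split=> // rest.
by rewrite iterSr cat_cons H h2.
Qed.

Lemma wp_cat t1 t2 p q s Q :
  wp t1 p s (fun s1 => wp t2 q s1 Q) -> wp (t1 + t2) (p ++ q) s Q.
Proof.
move=> [t' [s' [h1 h2 [t'' [s'' [h3 h4 h5]]]]]].
exists (t'' + t')%N, s''; split=> //; first by rewrite addnC leq_add.
by move=> rest; rewrite iterD -catA h2 h4.
Qed.

Lemma wp_if t b p1 p2 s Q :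
  wp t (if eval_test s b then p1 else p2) s Q -> wp t.+1 [:: If b p1 p2] s Q.
Proof.
move=> [t' [s' [h1 h2 h3]]]; exists t'.+1, s'; split=> // rest.
by rewrite iterSr /= h2.
Qed.

Lemma wp_while N t b body (J : nat -> state R -> Prop) s :
  J 0%N s ->
  (forall m s1, (m < N)%N -> J m s1 -> eval_test s1 b /\ wp t body s1 (J m.+1)) ->
  (forall s1, J N s1 -> ~~ eval_test s1 b) ->
  wp (N * t.+1 + 1) [:: While b body] s (J N).
Proof.
move=> J0 JS JN.
suff H : forall k m s1, (m + k = N)%N -> J m s1 ->
    wp (k * t.+1 + 1) [:: While b body] s1 (J N) by exact: (H N 0%N).
elim=> [|k IH] m s1 mk Jm.
  rewrite addn0 in mk; subst m.
  exists 1%N, s1; split=> // rest /=; by rewrite (negbTE (JN _ Jm)).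
have [tb [t' [s' [h1 h2 /IH]]]] := JS m s1 ltac:(lia) Jm.
move=> /(_ ltac:(lia)) [t'' [s'' [h3 h4 h5]]].
exists (t'' + t').+1, s''; split=> //; first by nia.
by move=> rest; rewrite iterSr /= tb iterD h2; exact: h4.
Qed.

(* [mi], [mr] and [ma] list the index registers, the real registers and the
   arrays that may have changed. *)
Definition same_off (mi mr ma : seq nat) s s' : Prop :=
  [/\ forall x, x \notin mi -> idx s' x = idx s x,
      forall x, x \notin mr -> reals s' x = reals s x
    & forall a, a \notin ma -> arrays s' a = arrays s a].

Lemma same_idx mi mr ma s s' : same_off mi mr ma s s' ->
  forall x, x \notin mi -> idx s' x = idx s x.
Proof. by case. Qed.

Lemma same_reals mi mr ma s s' : same_off mi mr ma s s' ->
  forall x, x \notin mr -> reals s' x = reals s x.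
Proof. by case. Qed.

Lemma same_arrays mi mr ma s s' : same_off mi mr ma s s' ->
  forall a, a \notin ma -> arrays s' a = arrays s a.
Proof. by case. Qed.

Lemma same_refl mi mr ma s : same_off mi mr ma s s.
Proof. by split. Qed.

Lemma same_trans mi mr ma mi' mr' ma' s s1 s2 :
  {subset mi' <= mi} -> {subset mr' <= mr} -> {subset ma' <= ma} ->
  same_off mi mr ma s s1 -> same_off mi' mr' ma' s1 s2 -> same_off mi mr ma s s2.
Proof.
move=> si sr sa [i1 r1 a1] [i2 r2 a2]; split=> x Hx.
- by rewrite i2 ?i1 //; apply: contra Hx => /si.
- by rewrite r2 ?r1 //; apply: contra Hx => /sr.
- by rewrite a2 ?a1 //; apply: contra Hx => /sa.
Qed.

Lemma upd_neq (A : Type) (f : nat -> A) x v y : y != x -> upd f x v y = f y.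
Proof. by rewrite /upd => /negbTE ->. Qed.

Lemma same_set_idx mi mr ma s s1 x v : x \in mi ->
  same_off mi mr ma s s1 -> same_off mi mr ma s (set_idx s1 x v).
Proof.
move=> xm [h1 h2 h3]; split=> // y Hy /=; rewrite upd_neq ?h1 //.
by apply: contra Hy => /eqP ->.
Qed.

Lemma same_set_real mi mr ma s s1 x v : x \in mr ->
  same_off mi mr ma s s1 -> same_off mi mr ma s (set_real s1 x v).
Proof.
move=> xm [h1 h2 h3]; split=> // y Hy /=; rewrite upd_neq ?h2 //.
by apply: contra Hy => /eqP ->.
Qed.

Lemma same_set_cell mi mr ma s s1 a i j v : a \in ma ->
  same_off mi mr ma s s1 -> same_off mi mr ma s (set_cell s1 a i j v).
Proof.
move=> xm [h1 h2 h3]; split=> // y Hy /=; rewrite upd_neq ?h3 //.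
by apply: contra Hy => /eqP ->.
Qed.

Lemma same_coins mi mr ma s s1 c :
  same_off mi mr ma s s1 ->
  same_off mi mr ma s (State (idx s1) (reals s1) (arrays s1) c).
Proof. by []. Qed.

(* Index register 4 holds the constant 1. *)
Definition For (i b : nat) (body : program) : program :=
  [:: IdxConst i 0; While (IdxLt i b) (body ++ [:: IdxAdd i i 4])].

(** A round costs the body plus one test and one increment; two more steps initialise the counter
    and fail the last test. The body must establish [I] at the state after the increment, since the
    increment belongs to the loop. *)
Lemma wp_for N t i b body mi mr ma (I : nat -> state R -> Prop) s :
  i \in mi -> b \notin mi -> 4 \notin mi -> idx s b = N -> idx s 4 = 1%N ->
  I 0%N (set_idx s i 0) ->
  (forall m s1, (m < N)%N -> same_off mi mr ma s s1 -> idx s1 i = m -> I m s1 ->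
    wp t body s1 (fun s2 => [/\ same_off mi mr ma s s2, idx s2 i = m
                            & I m.+1 (set_idx s2 i m.+1)])) ->
  wp (N * (t + 2) + 2) (For i b body) s
     (fun s' => same_off mi mr ma s s' /\ I N s').
Proof.
move=> im bm fm sb s4 I0 IS.
pose J m s1 := [/\ same_off mi mr ma s s1, idx s1 i = m & I m s1].
rewrite addnS; apply: wp_step; first by [].
rewrite addn2.
apply: (@wp_mono _ _ _ (J N)); last by move=> s' [].
apply: wp_while.
- by split=> //=; [apply: same_set_idx => //; exact: same_refl | rewrite /upd eqxx].
- move=> m s1 mN [s1s s1i Im].
  split; first by rewrite /= s1i (same_idx s1s) // sb.
  rewrite -addn1; apply: wp_cat; apply: wp_mono (IS _ _ mN s1s s1i Im) _.
  move=> s2 [s2s s2i IS2]; apply: wp_step; first by [].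
  apply: wp_nil; rewrite /= s2i (same_idx s2s) // s4 addn1.
  by split=> //=; [apply: same_set_idx | rewrite /upd eqxx].
- by move=> s1 [s1s s1i _]; rewrite /= s1i (same_idx s1s) // sb ltnn.
Qed.

End TimedTriples.

Ltac same := by repeat first
  [ apply: same_set_idx => // | apply: same_set_real => //
  | apply: same_set_cell => // | apply: same_coins | exact: same_refl ].
Ltac instr := apply: wp_step; first by [].

(** Index registers 0, 1 and 3 hold n, d and K; arrays 0, 3 and 4 hold the points, the random matrix
    and the sketches. The row treated is the one in index register 2. *)
Definition sketch_row : program :=
  For 7 3 ([:: RealConst 2 0] ++
    For 8 1 [:: ReadCell 3 3 7 8; ReadCell 4 0 2 8; RealMul 3 3 4; RealAdd 2 2 3]
    ++ [:: WriteCell 4 2 7 2]).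

(** The machine has no absolute value, so it is computed as the square root of a square. The l1
    distance of the two sketches ends in real register 2. *)
Definition sketch_dist (x y : nat) : program :=
  RealConst 2 0 ::
  For 7 3 [:: ReadCell 3 4 x 7; ReadCell 4 4 y 7; RealSub 3 3 4;
              RealMul 3 3 3; RealSqrt 3 3; RealAdd 2 2 3].

(** * Correctness and cost of the sketch macros *)

Section Macros.
Context {R : realType} (tape : nat -> R).
Implicit Types (s : state R).

Lemma set_cellE s a i j v a' i' j' :
  arrays (set_cell s a i j v) a' i' j' =
  if [&& a' == a, i' == i & j' == j] then v else arrays s a' i' j'.
Proof.
rewrite /set_cell /set_array /= /upd.
by have [->|] := eqVneq a' a; have [->|] := eqVneq i' i; have [->|] := eqVneq j' j.
Qed.

Lemma wp_sketch_row s : idx s 4 = 1%N ->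
  wp tape (idx s 3 * (idx s 1 * 6 + 6) + 2) sketch_row s (fun s' =>
    same_off [:: 7; 8] [:: 2; 3; 4] [:: 4] s s' /\
    forall i r, arrays s' 4 i r =
      if (i == idx s 2) && (r < idx s 3)%N
      then \sum_(0 <= j < idx s 1) arrays s 3 r j * arrays s 0 i j
      else arrays s 4 i r).
Proof.
move=> s4.
have -> : (idx s 1 * 6 + 6 = (1 + ((idx s 1 * (4 + 2) + 2) + 1)) + 2)%N by lia.
apply: (@wp_for _ _ _ _ _ _ _ _ _ _ (fun m s' => forall i r, arrays s' 4 i r =
      if (i == idx s 2) && (r < m)%N
      then \sum_(0 <= j < idx s 1) arrays s 3 r j * arrays s 0 i j
      else arrays s 4 i r)) => //.
  by move=> i r; rewrite andbF.
move=> m s1 mK ss1 s1m I1.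
apply: wp_cat; instr; apply: wp_nil.
apply: wp_cat.
set s2 := set_real _ _ _.
have ss2 : same_off [:: 7; 8] [:: 2; 3; 4] [:: 4] s s2 by same.
have s2m : idx s2 7 = m by [].
have s2r : arrays s2 4 = arrays s1 4 by [].
have s2z : reals s2 2 = 0 by [].
clearbody s2.
have ss3E s3 : same_off [:: 8] [:: 2; 3; 4] [::] s2 s3 ->
    same_off [:: 7; 8] [:: 2; 3; 4] [:: 4] s s3.
  by apply: same_trans ss2 => //; apply/allP.
apply: wp_mono.
  apply: (@wp_for _ _ _ _ _ _ _ [:: 8] [:: 2; 3; 4] [::] (fun m' s' =>
    reals s' 2 = \sum_(0 <= j < m') arrays s 3 m j * arrays s 0 (idx s 2) j)) => //=.
  - by rewrite (same_idx ss2).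
  - by rewrite (same_idx ss2).
  - by rewrite big_geq.
  move=> m' s3 m'd ss3 s3m I3; do 4 instr; apply: wp_nil.
  split=> //=; first by same.
  have {}ss3' := ss3E _ ss3.
  rewrite /upd /= big_nat_recr //= I3 s3m (same_idx ss3) //= s2m.
  by rewrite !(same_arrays ss3') //= (same_idx ss3').
move=> s3 [ss3 I3]; instr; apply: wp_nil.
have ss3' := ss3E _ ss3; split.
- by same.
- by rewrite /= (same_idx ss3).
move=> i r; rewrite [LHS](set_cellE s3) /= (same_idx ss3') // (same_idx ss3) // s2m.
rewrite (same_arrays ss3) //= s2r I1 I3 ltnS.
have [->|ir] /= := eqVneq i (idx s 2) => //.
by have [->|rm] := eqVneq r m; [rewrite leqnn | rewrite ltn_neqAle rm].
Qed.

Lemma wp_sketch_dist x y s : x != 7%N -> y != 7%N -> idx s 4 = 1%N ->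
  wp tape (idx s 3 * 8 + 3) (sketch_dist x y) s (fun s' =>
    same_off [:: 7] [:: 2; 3; 4] [::] s s' /\
    reals s' 2 = \sum_(0 <= r < idx s 3)
                 `|arrays s 4 (idx s x) r - arrays s 4 (idx s y) r|).
Proof.
move=> x7 y7 s4; rewrite addn3; instr.
rewrite -addn2; set s0 := set_real _ _ _.
have ss0 : same_off [:: 7] [:: 2; 3; 4] [::] s s0 by same.
apply: wp_mono.
  apply: (@wp_for _ _ _ 6 7 3 _ [:: 7] [:: 2; 3; 4] [::] (fun m s' =>
    reals s' 2 = \sum_(0 <= r < m) `|arrays s 4 (idx s x) r - arrays s 4 (idx s y) r|)) => //=.
    by rewrite big_geq.
  move=> m s1 mK ss1 s1m I1; do 6 instr; apply: wp_nil; split=> //=; first by same.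
  rewrite /upd /= big_nat_recr //= I1 s1m !(same_idx ss1) ?inE //.
  by rewrite (same_arrays ss1) //= -expr2 sqrtr_sqr.
move=> s' [ss' ->]; split=> //.
by apply: same_trans ss'.
Qed.

End Macros.

(** * The programs *)

(** Index register 5 is never written and serves as the constant 0, here as the row of array 1 in
    which vectors are passed. *)
Definition copy_row : program :=
  For 8 1 [:: ReadCell 3 1 5 8; WriteCell 0 2 8 3].

(* Real register 3 runs through the powers 2 ^ (m ^ 2) until it reaches n at
   m = K, real register 4 holds their ratios 2 ^ (2 m + 1), and real register 1
   ends as the scale B ^ K. *)
Definition init_scale (B : nat) : program :=
  [:: IdxConst 4 1; RealConst 1 1; RealConst 3 1; RealConst 4 2; RealOfIdx 5 0;
      RealConst 6 B; RealConst 7 4;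
      While (RealLt 3 5)
        [:: RealMul 3 3 4; RealMul 4 4 7; RealMul 1 1 6; IdxAdd 3 3 4]].

Definition draw_matrix : program :=
  For 7 3 (For 8 1 [:: Random 2; WriteCell 3 7 8 2]).

Definition init_prog (B : nat) : program :=
  init_scale B ++ draw_matrix ++ For 2 0 sketch_row.

Definition update_prog : program := copy_row ++ sketch_row.

(* The query point is stored and sketched as an extra row of index n; index
   register 9 ends as the row whose sketch is nearest to that of the query. *)
Definition query_prog : program :=
  IdxAdd 2 0 5 :: copy_row ++ sketch_row ++ IdxConst 9 0 ::
  For 6 0 (sketch_dist 9 2 ++ [:: RealConst 9 0; RealAdd 8 2 9] ++
           sketch_dist 6 2 ++ [:: If (RealLt 2 8) [:: IdxAdd 9 6 5] [::]]) ++
  RealConst 2 0 ::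
  For 8 1 [:: ReadCell 3 0 2 8; ReadCell 4 0 9 8; RealSub 3 3 4; RealMul 3 3 3;
              RealAdd 2 2 3] ++
  RealSqrt 10 2 ::
  For 6 0 (sketch_dist 9 6 ++ [:: RealMul 2 2 1; RealAdd 2 2 10; WriteCell 2 5 6 2]).

Definition sketching (B : nat) : data_structure :=
  DataStructure (init_prog B) update_prog query_prog.

Lemma write_mxE (R : realType) m p (A : 'M[R]_(m, p)) f (i : 'I_m) (j : 'I_p) :
  write_mx A f i j = A i j.
Proof.
rewrite /write_mx; have -> : (insub (i : nat) : option 'I_m) = Some i := valK i.
by have -> : (insub (j : nat) : option 'I_p) = Some j := valK j.
Qed.

Section Programs.
Context {R : realType} (tape : nat -> R) (n d : nat).
Implicit Types (s : state R) (X : 'M[R]_(n, d)) (v : 'rV[R]_d).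

(** The matrix is drawn row by row, so its entry (r, j) is tape cell [r * d + j]; sketches can thus
    be stated on the tape alone. *)
Definition row_dot (r : nat) v : R := \sum_(j < d) tape (r * d + j) * v 0 j.

Definition sketch_norm (K : nat) v : R := \sum_(r < K) `|row_dot r v|.

Lemma row_dotB r u v : row_dot r (u - v) = row_dot r u - row_dot r v.
Proof.
by rewrite /row_dot -sumrB; apply: eq_bigr => j _; rewrite !mxE mulrBr.
Qed.

Lemma wp_copy_row s : idx s 4 = 1%N -> idx s 5 = 0%N ->
  wp tape (idx s 1 * 4 + 2) copy_row s (fun s' =>
    same_off [:: 8] [:: 3] [:: 0] s s' /\
    forall i j, arrays s' 0 i j =
      if (i == idx s 2) && (j < idx s 1)%N then arrays s 1 0 j
      else arrays s 0 i j).
Proof.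
move=> s4 s5.
apply: (@wp_for _ _ _ 2 _ _ _ _ _ _ (fun m s' => forall i j, arrays s' 0 i j =
      if (i == idx s 2) && (j < m)%N then arrays s 1 0 j
      else arrays s 0 i j)) => //.
  by move=> i j; rewrite andbF.
move=> m s1 md ss1 s1m I1; do 2 instr; apply: wp_nil; split=> //; first by same.
move=> i j; rewrite [LHS](set_cellE (set_real s1 3 _)) /= s1m (same_idx ss1) //.
rewrite I1 ltnS /upd /= (same_idx ss1) // s5 (same_arrays ss1) //=.
have [->|ir] /= := eqVneq i (idx s 2) => //.
by have [->|rm] := eqVneq j m; [rewrite leqnn | rewrite ltn_neqAle rm].
Qed.

Definition base_ok (K : nat) (W : R) s : Prop :=
  [/\ [/\ idx s 0 = n, idx s 1 = d, idx s 3 = K & idx s 4 = 1%N],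
      idx s 5 = 0%N, reals s 1 = W &
      forall r j, (r < K)%N -> (j < d)%N -> arrays s 3 r j = tape (r * d + j)].

(** Only rows below n are constrained, which leaves row n free as scratch space for queries. *)
Definition rows_ok (K : nat) X s : Prop :=
  forall i : 'I_n, (forall j : 'I_d, arrays s 0 i j = X i j) /\
    (forall r, (r < K)%N -> arrays s 4 i r = row_dot r (row i X)).

Lemma base_ok_same mi mr ma K W s s' :
  all [predC mi] [:: 0; 1; 3; 4; 5]%N -> 1%N \notin mr -> 3%N \notin ma ->
  same_off mi mr ma s s' -> base_ok K W s -> base_ok K W s'.
Proof.
move=> /and5P[/= i0 i1 i3 i4 /andP[i5 _]] r1 a3 ss [[h0 h1 h3 h4] h5 hr ha].
by split; [split| | |]; rewrite ?(same_idx ss) ?(same_reals ss) ?(same_arrays ss).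
Qed.

Lemma sketch_row_value K W s i v r : base_ok K W s ->
  (forall j : 'I_d, arrays s 0 i j = v 0 j) -> (r < K)%N ->
  \sum_(0 <= j < idx s 1) arrays s 3 r j * arrays s 0 i j = row_dot r v.
Proof.
move=> [[_ -> _ _] _ _ h3] h0 rK; rewrite big_mkord; apply: eq_bigr => j _.
by rewrite h3 // h0.
Qed.

(** The row [i0] is a plain natural, so that the lemma also covers the query, which stores its point
    in row n. *)
Lemma wp_update_prog K W s v (i0 : nat) : base_ok K W s -> idx s 2 = i0 ->
  (forall j : 'I_d, arrays s 1 0 j = v 0 j) ->
  wp tape (d * 4 + 2 + (K * (d * 6 + 6) + 2)) update_prog s (fun s' =>
    [/\ same_off [:: 7; 8] [:: 2; 3; 4] [:: 0; 4] s s',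
        forall i (j : 'I_d), arrays s' 0 i j = if i == i0 then v 0 j else arrays s 0 i j
      & forall i r, (r < K)%N ->
          arrays s' 4 i r = if i == i0 then row_dot r v else arrays s 4 i r]).
Proof.
move=> bs s2 sv.
have [[s0 sd sK s4] s5 _ _] := bs.
rewrite -{1}sd; apply: wp_cat.
apply: (wp_mono (wp_copy_row s4 s5)) => s1 [ss1 h1].
have bs1 : base_ok K W s1 by apply: base_ok_same ss1 bs.
have [[s10 s1d s1K s14] s15 _ _] := bs1.
rewrite -{1}s1K -{1}s1d; apply: (wp_mono (wp_sketch_row _ s14)) => s' [ss' h'].
have h0 i (j : 'I_d) : arrays s1 0 i j = if i == i0 then v 0 j else arrays s 0 i j.
  by rewrite h1 s2 sd ltn_ord andbT sv.
split.
- apply: same_trans ss' => //.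
  + by apply/allP.
  + by apply: same_trans ss1; [apply/allP|apply/allP|apply/allP|exact: same_refl].
- by move=> i j; rewrite (same_arrays ss').
move=> i r rK; rewrite h' (same_idx ss1) // s2 s1K rK andbT.
case: eqP => [->|_]; last by rewrite (same_arrays ss1).
apply: sketch_row_value bs1 _ rK => j.
by rewrite h0 eqxx.
Qed.

Definition sketch_inv K W X s := base_ok K W s /\ rows_ok K X s.

Lemma update_spec K W X s z i : sketch_inv K W X s ->
  wp tape (d * 4 + 2 + (K * (d * 6 + 6) + 2)) update_prog (update_state s z i)
    (sketch_inv K W (replace_point X z i)).
Proof.
move=> [bs rs].
have bs0 : base_ok K W (update_state s z i) by [].
apply: wp_mono (wp_update_prog (v := z) bs0 erefl _) _.
  by move=> j; exact: (write_mxE z _ 0).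
move=> s' [ss' h0 h4]; split; first by apply: base_ok_same ss' bs0.
move=> l; have [rl1 rl2] := rs l; split.
  by move=> j; rewrite h0 mxE val_eqE; case: eqP => // _; exact: rl1.
move=> r rK; rewrite h4 // val_eqE.
case: eqP => [->|/eqP li].
  by apply: eq_bigr => j _; rewrite !mxE eqxx.
rewrite [LHS]rl2 //; apply: eq_bigr => j _; rewrite !mxE (negbTE li) //.
Qed.

Lemma sketch_norm_dist K s x y (u v : 'rV_d) : idx s 3 = K ->
  (forall r, (r < K)%N -> arrays s 4 x r = row_dot r u) ->
  (forall r, (r < K)%N -> arrays s 4 y r = row_dot r v) ->
  \sum_(0 <= r < idx s 3) `|arrays s 4 x r - arrays s 4 y r|
  = sketch_norm K (u - v).
Proof.
move=> -> hu hv; rewrite big_mkord; apply: eq_bigr => r _.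
by rewrite hu // hv // row_dotB.
Qed.

(** This description of the answer holds for every tape and every [q]; randomness enters only when
    it is turned into an accuracy bound. *)
Definition query_result K (W : R) X (q : 'rV[R]_d) (u : 'rV[R]_n) : Prop :=
  exists b : 'I_n,
    (forall l, sketch_norm K (row b X - q) <= sketch_norm K (row l X - q)) /\
    (forall i, u 0 i = l2norm (q - row b X) + W * sketch_norm K (row b X - row i X)).

Definition query_steps K :=
  (1 + ((d * 4 + 2 + (K * (d * 6 + 6) + 2)) + (1 + ((n * (16 * K + 12) + 2) +
   (1 + ((d * 7 + 2) + (1 + (n * (8 * K + 8) + 2))))))))%N.

Lemma query_spec K W X s q : (0 < n)%N -> sketch_inv K W X s ->
  wp tape (query_steps K) query_prog (pass_vector s q)
    (fun s' => sketch_inv K W X s' /\ query_result K W X q (output s')).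
Proof.
move=> n0 [bs rs].
have bs0 : base_ok K W (pass_vector s q) by [].
set s0 := pass_vector s q in bs0 *.
have s0E a : a != 1%N -> arrays s0 a = arrays s a by move=> a1; rewrite /= /upd (negbTE a1).
have s01 (j : 'I_d) : arrays s0 1 0 j = q 0 j by exact: (write_mxE q _ 0).
have [[s00 s0d s0K s04] s05 s0W s0G] := bs0.
clearbody s0; rewrite /query_steps.
apply: wp_step; first by [].
set s1 := set_idx _ _ _.
have s12 : idx s1 2 = n by rewrite /= /upd /= s00 s05 addn0.
have bs1 : base_ok K W s1 by [].
have ss1 : same_off [:: 2] [::] [::] s0 s1 by same.
clearbody s1.
rewrite /query_prog (catA copy_row) -/update_prog; apply: wp_cat.
apply: (wp_mono (wp_update_prog (v := q) bs1 s12 _)).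
  by move=> j; rewrite (same_arrays ss1) // s01.
move=> s2 [ss2 h20 h24].
have bs2 : base_ok K W s2 by apply: base_ok_same ss2 bs1.
have s22 : idx s2 2 = n by rewrite (same_idx ss2).
(* Data rows have index below n, so storing the query in row n leaves them and their sketches
   intact. *)
have X2 (i : 'I_n) (j : 'I_d) : arrays s2 0 i j = X i j.
  rewrite h20 ltn_eqF // (same_arrays ss1) // s0E //; exact: (rs i).1.
have q2 (j : 'I_d) : arrays s2 0 n j = q 0 j by rewrite h20 eqxx.
have S2 (i : 'I_n) r : (r < K)%N -> arrays s2 4 i r = row_dot r (row i X).
  move=> rK; rewrite h24 // ltn_eqF // (same_arrays ss1) // s0E //; exact: (rs i).2.
have Sq2 r : (r < K)%N -> arrays s2 4 n r = row_dot r q by move=> rK; rewrite h24 ?eqxx.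
clear h20 h24 ss1 ss2 rs bs bs0 s00 s0d s0K s04 s05 s0W s0G bs1 s12 s0E s01.
have [[s20 s2d s2K s24] s25 s2W s2G] := bs2.
have dist2 s' x y (u v : 'rV_d) : idx s' 3 = K -> arrays s' 4 = arrays s2 4 ->
    (forall r, (r < K)%N -> arrays s2 4 (idx s' x) r = row_dot r u) ->
    (forall r, (r < K)%N -> arrays s2 4 (idx s' y) r = row_dot r v) ->
    \sum_(0 <= r < idx s' 3) `|arrays s' 4 (idx s' x) r - arrays s' 4 (idx s' y) r|
    = sketch_norm K (u - v).
  by move=> e3 e4 hu hv; apply: sketch_norm_dist => // r rK; rewrite e4 (hu, hv).
apply: wp_step; first by [].
set s3 := set_idx _ _ _.
have ss3 : same_off [:: 6; 7; 9] [:: 2; 3; 4; 8; 9] [::] s2 s3 by same.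
have s39 : idx s3 9 = 0%N by [].
clearbody s3; apply: wp_cat.
have F3 s' x : same_off [:: 6; 7; 9] [:: 2; 3; 4; 8; 9] [::] s3 s' ->
    x \notin [:: 6; 7; 9] -> idx s' x = idx s2 x.
  by move=> ss h; rewrite (same_idx ss) // (same_idx ss3).
have A3 s' a : same_off [:: 6; 7; 9] [:: 2; 3; 4; 8; 9] [::] s3 s' ->
    arrays s' a = arrays s2 a.
  by move=> ss; rewrite (same_arrays ss) // (same_arrays ss3).
have -> : (16 * K + 12 = ((K * 8 + 3) + (2 + ((K * 8 + 3) + 2))) + 2)%N by lia.
pose D (i : 'I_n) := sketch_norm K (row i X - q).
(* Search for the minimum: after m rounds [b] is at least as good as every row below m. The initial
   candidate is row 0, which exists because n is positive. *)
apply: wp_mono.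
  apply: (@wp_for _ _ _ _ _ _ _ [:: 6; 7; 9] [:: 2; 3; 4; 8; 9] [::] (fun m s' =>
    exists b : 'I_n, idx s' 9 = b /\ forall l : 'I_n, (l < m)%N -> D b <= D l)) => //.
  - by rewrite (same_idx ss3).
  - by rewrite (same_idx ss3).
  - by exists (Ordinal n0).
  move=> m s4 mn ss4 s4m [b [s49 hb]].
  have s43 : idx s4 3 = K by rewrite (F3 _ _ ss4).
  have s44 : idx s4 4 = 1%N by rewrite (F3 _ _ ss4).
  have s42 : idx s4 2 = n by rewrite (F3 _ _ ss4).
  rewrite -{1}s43; apply: wp_cat.
  apply: (wp_mono (wp_sketch_dist _ _ _ s44)) => // s5 [ss5].
  rewrite (dist2 _ _ _ (row b X) q) //; last 3 first.
  - by rewrite (A3 _ _ ss4).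
  - by move=> r rK; rewrite s49 S2.
  - by move=> r rK; rewrite s42 Sq2.
  (* Adding the constant 0 acts as a register move: it saves the current best distance in real
     register 8 before real register 2 is overwritten. *)
  move=> s52; do 2 instr.
  set s6 := set_real _ _ _.
  have s68 : reals s6 8 = D b by rewrite /= /upd /= s52 addr0.
  have ss6 : same_off [:: 7] [:: 2; 3; 4; 8; 9] [::] s4 s6.
    do 2 apply: same_set_real => //; by apply: same_trans ss5; try exact/allP; exact: same_refl.
  clearbody s6.
  have s63 : idx s6 3 = K by rewrite (same_idx ss6).
  have s64 : idx s6 4 = 1%N by rewrite (same_idx ss6).
  rewrite -{1}s63; apply: wp_cat.
  apply: (wp_mono (wp_sketch_dist _ _ _ s64)) => // s7 [ss7].
  rewrite (dist2 _ _ _ (row (Ordinal mn) X) q) //; last 3 first.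
  - by rewrite (same_arrays ss6) // (A3 _ _ ss4).
  - by move=> r rK; rewrite (same_idx ss6) // s4m -(S2 (Ordinal mn)).
  - by move=> r rK; rewrite (same_idx ss6) // s42 Sq2.
  rewrite -/(D _) => s72.
  have ss47 : same_off [:: 7] [:: 2; 3; 4; 8; 9] [::] s4 s7.
    by apply: same_trans ss7 => //; apply/allP.
  have ss37 : same_off [:: 6; 7; 9] [:: 2; 3; 4; 8; 9] [::] s3 s7.
    by apply: same_trans ss47 => //; apply/allP.
  have s76 : idx s7 6 = m by rewrite (same_idx ss47).
  apply: wp_if; rewrite /eval_test s72 (same_reals ss7) // s68.
  have [lt|ge] := ltP.
    instr; apply: wp_nil; split=> //; first by same.
    exists (Ordinal mn); split.
      by rewrite /= /upd /= s76 (F3 _ _ ss37) // s25 addn0.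
    move=> l; rewrite ltnS leq_eqVlt => /predU1P[lm|/hb].
      by rewrite (_ : l = Ordinal mn) //; exact/val_inj.
    exact/le_trans/ltW.
  apply: (@wp_weaken _ _ 0%N) => //; apply: wp_nil; split=> //.
  exists b; split; first by rewrite /= /upd /= (same_idx ss47).
  move=> l; rewrite ltnS leq_eqVlt => /predU1P[lm|/hb //].
  by rewrite (_ : l = Ordinal mn) //; exact/val_inj.
clear s39 => s4 [ss4 [b [s49 hb]]].
apply: wp_step; first by [].
set s5 := set_real _ _ _.
have ss5 : same_off [:: 6; 7; 9] [:: 2; 3; 4; 8; 9] [::] s3 s5 by same.
have s59 : idx s5 9 = b by [].
have s52 : reals s5 2 = 0 by [].
clearbody s5; apply: wp_cat.
apply: wp_mono.
  apply: (@wp_for _ _ _ 5 _ _ _ [:: 8] [:: 2; 3; 4] [::] (fun m s' =>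
    reals s' 2 = \sum_(0 <= j < m) (arrays s2 0 n j - arrays s2 0 b j) ^+ 2)) => //.
  - by rewrite (F3 _ _ ss5).
  - by rewrite (F3 _ _ ss5).
  - by rewrite big_geq.
  move=> m s6 md ss6 s6m I6; do 5 instr; apply: wp_nil; split=> //; first by same.
  rewrite big_nat_recr //= /upd /= I6 s6m !(same_idx ss6) // (F3 _ _ ss5) //.
  by rewrite !(same_arrays ss6) // !(A3 _ _ ss5) // s22 s59 expr2.
move=> s6 [ss6 h6]; apply: wp_step; first by [].
set s7 := set_real _ _ _.
have s7r : reals s7 10 = l2norm (q - row b X).
  rewrite /= /upd /= h6 /l2norm big_mkord; congr Num.sqrt.
  by apply: eq_bigr => j _; rewrite q2 X2 !mxE.
have ss7 : same_off [:: 6; 7; 8; 9] [:: 2; 3; 4; 8; 9; 10] [::] s2 s7.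
  apply: same_set_real => //; apply: same_trans ss6; try exact/allP.
  apply: same_trans ss5; try exact/allP.
  by apply: same_trans ss3; try exact/allP; exact: same_refl.
have s79 : idx s7 9 = b by rewrite /= (same_idx ss6).
clearbody s7.
have bs7 : base_ok K W s7 by apply: base_ok_same ss7 bs2.
have -> : (8 * K + 8 = ((K * 8 + 3) + 3) + 2)%N by lia.
apply: wp_mono.
  apply: (@wp_for _ _ _ _ _ _ _ [:: 6; 7] [:: 2; 3; 4] [:: 2] (fun m s' =>
    forall i : 'I_n, (i < m)%N -> arrays s' 2 0 i =
      l2norm (q - row b X) + W * sketch_norm K (row b X - row i X))) => //.
  - by rewrite (same_idx ss7).
  - by rewrite (same_idx ss7).
  move=> m s8 mn ss8 s8m I8.
  have s83 : idx s8 3 = K by rewrite (same_idx ss8) // (same_idx ss7).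
  have s84 : idx s8 4 = 1%N by rewrite (same_idx ss8) // (same_idx ss7).
  rewrite -{1}s83; apply: wp_cat.
  apply: (wp_mono (wp_sketch_dist _ _ _ s84)) => // s9 [ss9].
  rewrite (dist2 _ _ _ (row b X) (row (Ordinal mn) X)) //; last 3 first.
  - by rewrite (same_arrays ss8) // (same_arrays ss7).
  - by move=> r rK; rewrite (same_idx ss8) // s79 S2.
  - by move=> r rK; rewrite s8m -(S2 (Ordinal mn)).
  move=> s92.
  have ss9' : same_off [:: 6; 7] [:: 2; 3; 4] [:: 2] s7 s9.
    by apply: same_trans ss9 => //; apply/allP.
  do 3 instr; apply: wp_nil; split; first by same.
    by rewrite /= (same_idx ss9).
  move=> i; rewrite ltnS => im.
  rewrite [LHS](set_cellE (set_real (set_real s9 _ _) _ _)) /=.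
  rewrite !(same_idx ss9) // s8m (same_idx ss8) // (same_idx ss7) // s25 eqxx /=.
  rewrite /upd /= s92 !(same_reals ss9') // s7r (same_reals ss7) // s2W.
  have [iE|im'] := eqVneq (i : nat) m.
    by rewrite addrC mulrC (_ : Ordinal mn = i) //; exact/val_inj.
  by rewrite (same_arrays ss9) // I8 // ltn_neqAle im'.
move=> s' [ss' h'].
split; last first.
  exists b; split; first by move=> l; exact: hb.
  by move=> i; rewrite mxE h'.
split; first by apply: base_ok_same ss' bs7.
move=> i; split=> [j|r rK].
  by rewrite (same_arrays ss') // (same_arrays ss7) // X2.
by rewrite (same_arrays ss') // (same_arrays ss7) // S2.
Qed.

End Programs.

(** * Correctness and cost of the initialisation *)

Section Initialisation.
Context {R : realType} (tape : nat -> R) (n d : nat).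
Implicit Types (s : state R) (X : 'M[R]_(n, d)).

(** The two hypotheses say that the loop test succeeds for every m below K and fails at K. The
    exponent m ^ 2 is advanced by 2 m + 1 per round, so no multiplication of indices is needed. *)
Lemma wp_init_scale B K s : (n <= 2 ^ (K ^ 2))%N ->
  (forall m, (m < K)%N -> (2 ^ (m ^ 2) < n)%N) ->
  [/\ idx s 0 = n, idx s 1 = d, idx s 3 = 0%N & idx s 5 = 0%N] ->
  wp tape (K * 5 + 8) (init_scale B) s (fun s' =>
    [/\ [/\ idx s' 0 = n, idx s' 1 = d, idx s' 3 = K & idx s' 4 = 1%N],
        idx s' 5 = 0%N, reals s' 1 = B%:R ^+ K,
        arrays s' = arrays s & coins s' = coins s]).
Proof.
move=> nK Kn [s0 s1 s3 s5].
have -> : (K * 5 + 8 = (K * 5 + 1).+4.+3)%N by lia.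
do 7 instr.
pose J m s' := [/\ [/\ idx s' 0 = n, idx s' 1 = d, idx s' 3 = m & idx s' 4 = 1%N],
   idx s' 5 = 0%N, reals s' 1 = B%:R ^+ m, arrays s' = arrays s /\ coins s' = coins s
 & [/\ reals s' 3 = (2 ^ (m ^ 2))%:R, reals s' 4 = (2 ^ (2 * m + 1))%:R,
       reals s' 5 = n%:R, reals s' 6 = B%:R & reals s' 7 = 4%:R]].
apply: (@wp_mono _ _ _ _ _ (J K)); last by move=> s' [[? ? ? ?] ? ? [? ?] _].
apply: wp_while.
- by split; [split|..|split|split]; rewrite //= /upd /= ?s0.
- move=> m s' mK [[j0 j1 j3 j4] j5 jr [ja jc] [h3 h4 h5 h6 h7]]; split.
    by rewrite /= h3 h5 ltr_nat Kn.
  do 4 instr; apply: wp_nil; split; [split|..|split|split];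
    rewrite //= /upd /= ?j3 ?j4 ?h3 ?h4 ?h7 ?jr ?h6 ?addn1 ?exprSr //.
  + by rewrite -natrM -expnD; congr (2 ^ _)%:R; lia.
  + by rewrite -natrM (_ : 4 = 2 ^ 2)%N // -expnD; congr (2 ^ _)%:R; lia.
- move=> s' [_ _ _ _ [h3 _ h5 _ _]].
  by rewrite /= h3 h5 ltr_nat -leqNgt.
Qed.

(** The number of coins drawn is part of both loop invariants, as it identifies the tape cell read
    next. *)
Lemma wp_draw_matrix K s : idx s 4 = 1%N -> coins s = 0%N ->
  idx s 3 = K -> idx s 1 = d ->
  wp tape (K * (d * 4 + 4) + 2) draw_matrix s (fun s' =>
    same_off [:: 7; 8] [:: 2] [:: 3] s s' /\
    forall r j, (r < K)%N -> (j < d)%N -> arrays s' 3 r j = tape (r * d + j)).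
Proof.
move=> s4 sc s3 s1.
pose I m s' := coins s' = (m * d)%N /\
  forall r j, (r < m)%N -> (j < d)%N -> arrays s' 3 r j = tape (r * d + j).
have -> : (d * 4 + 4 = (d * (2 + 2) + 2) + 2)%N by lia.
suff H : wp tape (K * ((d * (2 + 2) + 2) + 2) + 2) draw_matrix s (fun s' =>
    same_off [:: 7; 8] [:: 2] [:: 3] s s' /\ I K s').
  by apply: wp_mono H _ => s' [ss [_ h]].
apply: (@wp_for _ _ _ _ _ _ _ _ _ _ I) => //.
move=> m s2 mK ss2 s27 [c2 a2].
apply: wp_mono.
  apply: (@wp_for _ _ _ _ _ _ _ [:: 8] [:: 2] [:: 3] (fun m' s' =>
    coins s' = (m * d + m')%N /\ forall r j, (j < d)%N ->
      (r < m)%N || (r == m) && (j < m')%N -> arrays s' 3 r j = tape (r * d + j))) => //.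
  - by rewrite (same_idx ss2) // s1.
  - by rewrite (same_idx ss2).
  - by split; rewrite /= ?c2 ?addn0 // => r j jd; rewrite andbF orbF => rm; apply: a2.
  move=> m' s5 m'd ss5 s58 [c5 a5]; do 2 instr; apply: wp_nil; split=> //.
    by apply: same_set_cell => //; apply: same_coins; same.
  have s57 : idx s5 7 = m by rewrite (same_idx ss5).
  split; first by rewrite /= c5 addnS.
  move=> r j jd; rewrite ltnS => rj.
  rewrite [LHS](set_cellE (State (idx s5) (upd (reals s5) 2 _) (arrays s5) _)) /=.
  rewrite s57 s58 /upd /= c5.
  have [/andP[/eqP -> /eqP ->]//|ne] := boolP ((r == m) && (j == m')).
  apply: a5 => //; case/orP: rj => [->//|/andP[rm jm]].
  by rewrite rm [(j < m')%N]ltn_neqAle jm andbT; move: ne; rewrite rm /= => ->; rewrite orbT.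
move=> s5 [ss5 [c5 a5]]; split.
- by apply: same_trans ss5; try exact/allP.
- by rewrite (same_idx ss5).
split; first by rewrite /= c5 mulSn addnC.
move=> r j; rewrite ltnS leq_eqVlt => rm jd; apply: a5 => //.
by rewrite jd andbT orbC.
Qed.

Definition init_steps K :=
  ((K * 5 + 8) + ((K * (d * 4 + 4) + 2) + (n * (K * (d * 6 + 6) + 4) + 2)))%N.

Lemma init_spec B K X eps : (n <= 2 ^ (K ^ 2))%N ->
  (forall m, (m < K)%N -> (2 ^ (m ^ 2) < n)%N) ->
  wp tape (init_steps K) (init_prog B) (init_state X eps)
    (sketch_inv tape K (B%:R ^+ K) X).
Proof.
move=> nK Kn; set s := init_state X eps.
have sX (i : 'I_n) (j : 'I_d) : arrays s 0 i j = X i j by exact: write_mxE.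
apply: wp_cat; apply: wp_mono; first by apply: wp_init_scale nK Kn _; split.
move=> s1 [[s10 s11 s13 s14] s15 s1W s1a s1c].
apply: wp_cat; apply: (wp_mono (wp_draw_matrix s14 s1c s13 s11)) => s2 [ss2 h2].
have bs2 : base_ok tape n d K (B%:R ^+ K) s2.
  by split=> //; [split|..]; rewrite ?(same_idx ss2) ?(same_reals ss2).
have s2X (i : 'I_n) (j : 'I_d) : arrays s2 0 i j = X i j.
  by rewrite (same_arrays ss2) // s1a.
have -> : (K * (d * 6 + 6) + 4 = (K * (d * 6 + 6) + 2) + 2)%N by lia.
have [[s20 s21 s23 s24] s25 _ _] := bs2.
apply: wp_mono.
  apply: (@wp_for _ _ _ _ _ _ _ [:: 2; 7; 8] [:: 2; 3; 4] [:: 4] (fun m s' =>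
    forall i : 'I_n, (i < m)%N -> forall r, (r < K)%N ->
       arrays s' 4 i r = row_dot tape r (row i X))) => //.
  move=> m s3 mn ss3 s32 I3.
  have bs3 : base_ok tape n d K (B%:R ^+ K) s3 by apply: base_ok_same ss3 bs2.
  have [[s30 s31 s33 s34] s35 _ _] := bs3.
  rewrite -{1}s33 -{1}s31; apply: (wp_mono (wp_sketch_row _ s34)) => s4 [ss4 h4].
  split; [| by rewrite (same_idx ss4) |].
    by apply: same_trans ss4; try exact/allP.
  move=> i; rewrite ltnS => im r rK; rewrite [LHS]h4 s32 s33 rK andbT.
  have [iE|im'] := eqVneq (i : nat) m; last by apply: I3 => //; rewrite ltn_neqAle im'.
  apply: sketch_row_value bs3 _ rK => j.
  by rewrite (same_arrays ss3) // s2X mxE.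
move=> s3 [ss3 h3]; split; first by apply: base_ok_same ss3 bs2.
by move=> i; split=> [j|]; [rewrite (same_arrays ss3) ?s2X | exact: h3].
Qed.

End Initialisation.

(** * Serving a schedule of requests *)

Section Serving.
Context {R : realType} (n d : nat).
Implicit Types (X : 'M[R]_(n, d)) (reqs : seq (request R n d)).

Definition serve_request X (r : request R n d) :=
  if r is Update z i then replace_point X z i else X.

Definition points_after X reqs := foldl serve_request X reqs.

(** All data sets that the schedule goes through. The list depends neither on the tape nor on the
    adversary, so a union bound may run over it. *)
Fixpoint versions X reqs : seq 'M[R]_(n, d) :=
  match reqs with
  | [::] => [:: X]
  | Update z i :: reqs' => X :: versions (replace_point X z i) reqs'
  | Query :: reqs' => versions X reqs'
  end.

Lemma size_versions X reqs : size (versions X reqs) = (count is_update reqs).+1.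
Proof. by elim: reqs X => //= [[z i|]] reqs IH X //=; rewrite IH. Qed.

Lemma mem_versions X reqs : X \in versions X reqs.
Proof. by elim: reqs => [|[z i|] reqs IH] //=; rewrite inE eqxx. Qed.

Lemma points_after_versions X reqs j :
  points_after X (take j reqs) \in versions X reqs.
Proof.
elim: reqs X j => [|r reqs IH] X [|j]; rewrite ?take0 ?mem_versions //=.
by case: r => [z i|] /=; rewrite ?inE IH ?orbT.
Qed.

(** A deterministic statement for a fixed tape: the adversary only influences [q], and
    [query_result] is available for every [q]. *)
Lemma serve_spec (tape : nat -> R) B K (tU tQ : nat) adversary reqs s X hist :
  (0 < n)%N ->
  (d * 4 + 2 + (K * (d * 6 + 6) + 2) <= tU)%N -> (query_steps n d K <= tQ)%N ->
  sketch_inv tape K (B%:R ^+ K) X s ->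
  let replies := serve (sketching B) tU tQ tape adversary reqs s X hist in
  all served_in_time replies /\
  forall j r, onth replies j = Some r ->
    if r is QueryReply _ Y q u
    then Y = points_after X (take j reqs) /\ query_result tape K (B%:R ^+ K) Y q u
    else True.
Proof.
move=> n0 hU hQ; elim: reqs s X hist => [|r reqs IH] s X hist Is /=; first by split=> // -[].
case: r => [z i|].
  have [h1 h2] := wp_run (wp_weaken hU (update_spec z i Is)).
  have [h3 h4] := IH _ _ hist h2.
  split; first by rewrite /= h1.
  by case=> [|j] r /=; [case=> <- | move/h4].
have [h1 [h2 h2']] := wp_run (wp_weaken hQ (query_spec (adversary hist) n0 Is)).
have [h3 h4] := IH _ _ (rcons hist (output (run tape tQ query_prog
  (pass_vector s (adversary hist))).2)) h2.
split; first by rewrite /= h1.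
by case=> [|j] r /=; [case=> <-; split | move/h4].
Qed.

End Serving.

(** * Small ball estimate for the random sketch *)

Section Cells.
Context {R : realType} (N : nat).
Hypothesis N0 : (0 < N)%N.

(** Rounding the tape to cells of length 1/N turns probabilities into counts of grid points;
    half-open cells are pairwise disjoint. *)
Definition cell (a : nat) : set R := `[a%:R / N%:R, a.+1%:R / N%:R[%classic.

Lemma measurable_cell a : measurable (cell a).
Proof. exact: measurable_itv. Qed.

Lemma cellP a x : cell a x -> a%:R <= N%:R * x < a.+1%:R.
Proof.
rewrite /cell /= in_itv /= => /andP[h1 h2].
by rewrite -ler_pdivrMl ?ltr0n // mulrC h1 /= -ltr_pdivlMl ?ltr0n // mulrC.
Qed.

Lemma cell_inj a b x : cell a x -> cell b x -> a = b.
Proof.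
move=> /cellP/andP[a1 a2] /cellP/andP[b1 b2].
have : (a < b.+1)%N by rewrite -(ltr_nat R); exact: le_lt_trans b2.
have : (b < a.+1)%N by rewrite -(ltr_nat R); exact: le_lt_trans a2.
by lia.
Qed.

Lemma uniform_prob_cell a : (a < N)%N ->
  uniform_prob (@ltr01 R) (cell a) = (N%:R^-1 : R)%:E.
Proof.
move=> aN; have N0' : 0 < N%:R :> R by rewrite ltr0n.
rewrite /uniform_prob integral_uniform_pdf setIidl; last first.
  move=> x /cellP /andP[h1 h2]; rewrite /= in_itv /=; apply/andP; split.
    by rewrite -(pmulr_rge0 _ N0'); exact: le_trans h1.
  rewrite -(ler_pM2l N0') mulr1; apply: ltW (lt_le_trans h2 _).
  by rewrite ler_nat.
rewrite (eq_integral (fun=> (1 : R)%:E)); last first.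
  move=> x; rewrite inE => /cellP /andP[h1 h2]; rewrite /uniform_pdf subr0 invr1.
  case: ifP => // /negP[]; apply/andP; split.
    by rewrite -(pmulr_rge0 _ N0'); exact: le_trans h1.
  rewrite -(ler_pM2l N0') mulr1; apply: ltW (lt_le_trans h2 _).
  by rewrite ler_nat.
rewrite integral_cst; last exact: measurable_cell.
rewrite mul1e; apply: (etrans (lebesgue_measure_itv _)).
rewrite /= lte_fin ltr_pM2r ?invr_gt0 // ltr_nat ltnSn.
by rewrite -EFinD -mulrBl -natrB // subSnn mul1r.
Qed.

End Cells.

Section CellEvents.
Context {disp : measure_display} {T : measurableType disp} {R : realType}
  (P : probability T R) (U : nat -> {RV P >-> R}) (N m : nat).
Hypotheses (iidU : iid_uniform01 U) (N0 : (0 < N)%N).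

Definition cell_event (g : nat -> nat) : set T :=
  \bigcap_(t in [set` iota 0 m]) (U t @^-1` cell N (g t)).

Lemma measurable_cell_event g : measurable (cell_event g).
Proof.
apply: fin_bigcap_measurable => [|t _]; first exact: finite_seq.
rewrite -[X in measurable X]setTI.
by apply: measurable_funPT => //; exact: measurable_cell.
Qed.

Lemma prob_cell_event g : (forall t, (g t < N)%N) ->
  P (cell_event g) = ((N%:R^-1 : R) ^+ m)%:E.
Proof.
move=> gN; have [iid1 iid2] := iidU.
rewrite /cell_event (iid2 _ (fun t => cell N (g t))) ?iota_uniq //; last first.
  by move=> i; exact: measurable_cell.
rewrite -[m in RHS](size_iota 0); elim: (iota 0 m) => [|t J IH].
  by rewrite big_nil expr0.
rewrite big_cons IH iid1 ?uniform_prob_cell //; last exact: measurable_cell.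
by rewrite -EFinM exprS.
Qed.

(** Grid tapes that differ within the first m entries give disjoint events, each of probability N ^
    (- m) by independence. *)
Lemma prob_cell_events (I : finType) (g : I -> nat -> nat) (A : {set I}) :
  (forall i t, (g i t < N)%N) ->
  (forall i i', (forall t, (t < m)%N -> g i t = g i' t) -> i = i') ->
  P (\bigcup_(i in [set` enum A]) cell_event (g i)) =
    (#|A|%:R * (N%:R^-1 : R) ^+ m)%:E.
Proof.
move=> gN ginj; rewrite measure_fin_bigcup.
- rewrite -fsbig_seq ?enum_uniq //=.
  under eq_bigr do rewrite prob_cell_event //.
  rewrite cardE; elim: (enum A) => [|i s IH]; first by rewrite big_nil mul0r.
  by rewrite big_cons IH -EFinD /= -[(size s).+1]add1n natrD mulrDl mul1r.
- exact: finite_seq.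
- move=> i i' _ _ [w [wi wi']]; apply: ginj => t tm.
  have tJ : [set` iota 0 m] t by rewrite /= mem_iota.
  have h1 : cell N (g i t) (U t w) := wi t tJ.
  have h2 : cell N (g i' t) (U t w) := wi' t tJ.
  exact: (cell_inj N0 h1 h2).
- by move=> i _; exact: measurable_cell_event.
Qed.

End CellEvents.

(** * The Euclidean norm *)

Section Norms.
Context {R : realType} {d : nat}.
Implicit Types u v : 'rV[R]_d.

Lemma l2norm_ge0 v : 0 <= l2norm v.
Proof. exact: sqrtr_ge0. Qed.

Lemma l2norm_sqr v : l2norm v ^+ 2 = \sum_j v 0 j ^+ 2.
Proof. by rewrite sqr_sqrtr // sumr_ge0 // => j _; exact: sqr_ge0. Qed.

Lemma l2normN v : l2norm (- v) = l2norm v.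
Proof. by congr Num.sqrt; apply: eq_bigr => j _; rewrite mxE sqrrN. Qed.

Lemma l2norm0 : l2norm (0 : 'rV[R]_d) = 0.
Proof.
by rewrite /l2norm big1 ?sqrtr0 // => j _; rewrite mxE expr0n.
Qed.

Lemma coord_le_l2norm v j : `|v 0 j| <= l2norm v.
Proof.
rewrite -sqrtr_sqr ler_wsqrtr // (bigD1 j) //= lerDl sumr_ge0 // => i _.
exact: sqr_ge0.
Qed.

Lemma l2norm_le_sum v : l2norm v <= \sum_j `|v 0 j|.
Proof.
have s0 : 0 <= \sum_j `|v 0 j| by apply: sumr_ge0.
rewrite -(ler_pXn2r (n := 2)) ?nnegrE ?l2norm_ge0 // l2norm_sqr expr2 mulr_suml.
apply: ler_sum => j _; rewrite -(real_normK (num_real (v 0 j))) expr2.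
by rewrite ler_wpM2l // (bigD1 j) //= lerDl sumr_ge0.
Qed.

Lemma cauchy_schwarz u v : \sum_j u 0 j * v 0 j <= l2norm u * l2norm v.
Proof.
have [u0|un0] := eqVneq (l2norm u) 0.
  rewrite u0 mul0r big1 // => j _.
  have := coord_le_l2norm u j; rewrite u0 normr_le0 => /eqP ->.
  by rewrite mul0r.
have [v0|vn0] := eqVneq (l2norm v) 0.
  rewrite v0 mulr0 big1 // => j _.
  have := coord_le_l2norm v j; rewrite v0 normr_le0 => /eqP ->.
  by rewrite mulr0.
have up : 0 < l2norm u by rewrite lt_def un0 l2norm_ge0.
have vp : 0 < l2norm v by rewrite lt_def vn0 l2norm_ge0.
set a := l2norm u in up un0 *; set b := l2norm v in vp vn0 *.
(* With a and b the two norms this sum equals 2 a b (a b - <u, v>), and a b is positive. *)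
have : 0 <= \sum_j (b * u 0 j - a * v 0 j) ^+ 2 by apply: sumr_ge0 => j _; exact: sqr_ge0.
have -> : \sum_j (b * u 0 j - a * v 0 j) ^+ 2 =
    2 * (a * b) * (a * b - \sum_j u 0 j * v 0 j).
  have -> : 2 * (a * b) * (a * b - \sum_j u 0 j * v 0 j) =
    b ^+ 2 * (\sum_j u 0 j ^+ 2) + a ^+ 2 * (\sum_j v 0 j ^+ 2)
    - 2 * (a * b) * \sum_j u 0 j * v 0 j.
    by rewrite -!l2norm_sqr -/a -/b; ring.
  rewrite !mulr_sumr -big_split -sumrB /=.
  by apply: eq_bigr => j _; ring.
rewrite pmulr_rge0 ?subr_ge0 // mulr_gt0 ?ltr0n // mulr_gt0 //.
Qed.

Lemma l2normD u v : l2norm (u + v) <= l2norm u + l2norm v.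
Proof.
rewrite -(ler_pXn2r (n := 2)) ?nnegrE ?addr_ge0 ?l2norm_ge0 // sqrrD !l2norm_sqr.
have -> : \sum_j (u + v) 0 j ^+ 2 =
    \sum_j u 0 j ^+ 2 + (\sum_j u 0 j * v 0 j) *+ 2 + \sum_j v 0 j ^+ 2.
  rewrite -sumrMnl -!big_split; apply: eq_bigr => j _ /=.
  by rewrite mxE sqrrD.
by rewrite lerD2r lerD2l lerMn2r /= cauchy_schwarz.
Qed.

End Norms.

Lemma card_diameter N (A : {set 'I_N}) D :
  (forall x y, x \in A -> y \in A -> (x <= y + D)%N) -> (#|A| <= D.+1)%N.
Proof.
move=> AD; have [->|[x0 x0A]] := set_0Vmem A; first by rewrite cards0.
case: (arg_minnP (fun x : 'I_N => x : nat) x0A) => m mA mmin.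
rewrite cardE -(size_map val) -(size_iota m D.+1).
apply: uniq_leq_size; first by rewrite map_inj_uniq ?enum_uniq //; exact: val_inj.
move=> y /mapP[x]; rewrite mem_enum => xA ->.
by rewrite mem_iota mmin //= addnS ltnS AD.
Qed.

(** * Anti-concentration by counting grid points *)

Section AntiConcentration.
Context {R : realType} {d : nat} (v : 'rV[R]_d) (N : nat).

Definition grid_dot (g : {ffun 'I_d -> 'I_N}) : R := \sum_j (g j)%:R * v 0 j.

Definition set_coord p (g : {ffun 'I_d -> 'I_N}) y : {ffun 'I_d -> 'I_N} :=
  [ffun j => if j == p then y else g j].

Lemma grid_dot_set_coordB p g y z :
  grid_dot (set_coord p g y) - grid_dot (set_coord p g z) = (y%:R - z%:R) * v 0 p.
Proof.
rewrite /grid_dot -sumrB (bigD1 p) //= !ffunE eqxx -mulrBl big1 ?addr0 //.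
by move=> j jp; rewrite !ffunE (negbTE jp) subrr.
Qed.

(* Resampling the coordinate [p] injects 'I_N x A into the pairs (g, y) such
   that [set_coord p g y] is in A, and each g has few such y. *)
Lemma card_small_grid_dot p D (A : {set {ffun 'I_d -> 'I_N}}) : v 0 p != 0 ->
  (forall g, g \in A -> `|grid_dot g| <= D%:R * `|v 0 p|) ->
  (N * #|A| <= (2 * D).+1 * N ^ d)%N.
Proof.
move=> vp AD.
pose S := [pred z : {ffun 'I_d -> 'I_N} * 'I_N | set_coord p z.1 z.2 \in A].
(* The second component keeps the overwritten value, so writing it back recovers [g]; this gives
   both membership in [S] and injectivity. *)
pose phi (z : 'I_N * {ffun 'I_d -> 'I_N}) := (set_coord p z.2 z.1, z.2 p).
have phiK x g : set_coord p (phi (x, g)).1 (phi (x, g)).2 = g.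
  by apply/ffunP => j; rewrite !ffunE; case: eqP => [->|].
have phi_inj : injective phi.
  move=> [x g] [y h] e.
  have gh : g = h by rewrite -(phiK x g) -(phiK y h) e.
  subst h; congr (_, _); move: e => [/ffunP/(_ p)].
  by rewrite !ffunE eqxx.
have : (#|[predX 'I_N & A]| <= #|S|)%N.
  rewrite -(fintype.card_image phi_inj); apply: subset_leq_card; apply/fintype.subsetP => z.
  by move=> /fintype.imageP[[x g]]; rewrite !inE /= => gA ->; rewrite phiK.
rewrite cardX card_ord => /leq_trans; apply.
rewrite -sum1_card -(pair_big_dep predT (fun g y => set_coord p g y \in A) (fun _ _ => 1%N)) /=.
have -> : (N ^ d = #|{ffun 'I_d -> 'I_N}|)%N by rewrite card_ffun !card_ord.
rewrite mulnC -sum_nat_const; apply: leq_sum => g _.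
rewrite sum1dep_card; apply: card_diameter => x y; rewrite !inE => xA yA.
(* Two values of coordinate p that both land in [A] have dot products at most 2 D |v_p| apart, while
   these differ by exactly (x - y) v_p. *)
have : `|x%:R - y%:R| <= (2 * D)%:R :> R.
  rewrite -(ler_pM2r (x := `|v 0 p|)) ?normr_gt0 // -normrM -(grid_dot_set_coordB p g).
  rewrite (le_trans (ler_normB _ _)) // mul2n -addnn natrD mulrDl lerD // AD //.
move=> /(le_trans (ler_norm _)); rewrite lerBlDl -natrD ler_nat //.
Qed.

End AntiConcentration.

Section Distortion.
Context {R : realType} {d : nat} (K W : nat).

(* A grid point whose dot product with [v] exceeds twice the possible rounding
   error of all coordinates certifies a large entry of the sketch of [v]. *)
Lemma few_bad_grid_points (v : 'rV[R]_d) :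
  exists Bad : {set {ffun 'I_K -> {ffun 'I_d -> 'I_W}}},
    (W ^ K * #|Bad| <= (4 * d + 1) ^ K * (W ^ d) ^ K)%N /\
    forall f tape, f \notin Bad ->
      (forall r j, (f r j)%:R <= W%:R * tape (r * d + j)%N < (f r j).+1%:R) ->
      l2norm v <= W%:R * sketch_norm tape K v.
Proof.
have [->|v0] := eqVneq v 0.
  exists finset.set0; split; first by rewrite cards0 muln0.
  by move=> f tape _ _; rewrite l2norm0 mulr_ge0 // sumr_ge0.
have [p [vp vmax]] : exists p, v 0 p != 0 /\ forall j, `|v 0 j| <= `|v 0 p|.
  have /rV0Pn[j0 hj0] := v0.
  case: (@arg_maxP _ _ _ j0 xpredT (fun j => `|v 0 j|) isT) => p _ hp.
  exists p; split; last by move=> j; exact: hp.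
  by rewrite -normr_gt0 (lt_le_trans _ (hp j0 isT)) ?normr_gt0.
(* Rounding costs at most d |v_p|, since p is a largest coordinate; above the threshold 2 d |v_p|
   there remains d |v_p|, which bounds the l1 norm and hence the norm of [v]. A grid point is bad
   only if all K rows lie in [A], whence the K-th power. *)
pose A := [set g : {ffun 'I_d -> 'I_W} | `|grid_dot v g| <= (2 * d)%:R * `|v 0 p| ]%SET.
exists [set f | f \in ffun_on (mem A)]%SET; split.
  rewrite cardsE card_ffun_on card_ord -!expnMn.
  have mono x y : (x <= y)%N -> (x ^ K <= y ^ K)%N.
    by case: (K) => // K'; rewrite leq_exp2r.
  apply: mono; rewrite addn1 (_ : 4 * d = 2 * (2 * d))%N; last by lia.
  by apply: (card_small_grid_dot vp) => g; rewrite inE.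
move=> f tape fBad ftape.
have [r fr] : exists r, f r \notin A.
  apply/existsP; rewrite -negb_forall; apply: contra fBad => /forallP h.
  by rewrite inE; apply/ffun_onP => r; exact: h.
have sumv : \sum_j `|v 0 j| <= d%:R * `|v 0 p|.
  apply: (@le_trans _ _ (\sum_(j < d) `|v 0 p|)); first exact: ler_sum.
  by rewrite sumr_const card_ord mulr_natl.
apply: (le_trans (l2norm_le_sum v)); apply: (le_trans sumv).
apply: (@le_trans _ _ `|W%:R * row_dot tape r v|); last first.
  rewrite normrM normr_nat ler_wpM2l // /sketch_norm (bigD1 r) //= lerDl.
  by rewrite sumr_ge0.
(* Each grid coordinate is the integer part of W times a tape value, so the error is at most the l1
   norm of [v]. *)
have close : `|W%:R * row_dot tape r v - grid_dot v (f r)| <= d%:R * `|v 0 p|.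
  apply: le_trans sumv; rewrite /row_dot /grid_dot mulr_sumr -sumrB.
  apply: (le_trans (ler_norm_sum _ _ _)); apply: ler_sum => j _.
  rewrite mulrA -mulrBl normrM ler_piMl // ler_norml.
  by have /andP[h1 h2] := ftape r j; move: h2; rewrite -natr1 => h2; lra.
move: fr; rewrite inE -ltNge natrM => fr.
have := ler_normB (W%:R * row_dot tape r v) (W%:R * row_dot tape r v - grid_dot v (f r)).
rewrite subKr => h; lra.
Qed.

End Distortion.

(** * Probability of a good tape *)

Section GoodTape.
Context {R : realType} {d : nat} (K W : nat).

(** The first condition, which a uniform tape violates only with probability 0, gives the upper
    bound on [sketch_norm]; the second is the lower bound. *)
Definition good_tape (tape : nat -> R) (vs : seq 'rV[R]_d) : Prop :=
  (forall (r : 'I_K) (j : 'I_d), 0 <= tape (r * d + j)%N <= 1) /\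
  forall v, v \in vs -> l2norm v <= W%:R * sketch_norm tape K v.

Lemma few_bad_grid_points_seq (vs : seq 'rV[R]_d) :
  exists Bad : {set {ffun 'I_K -> {ffun 'I_d -> 'I_W}}},
    (W ^ K * #|Bad| <= size vs * ((4 * d + 1) ^ K * (W ^ d) ^ K))%N /\
    forall f (tape : nat -> R), f \notin Bad ->
      (forall r j, (f r j)%:R <= W%:R * tape (r * d + j)%N < (f r j).+1%:R) ->
      forall v, v \in vs -> l2norm v <= W%:R * sketch_norm tape K v.
Proof.
elim: vs => [|v vs [Bad [cB hB]]].
  by exists finset.set0; rewrite cards0 muln0.
have [Badv [cv hv]] := few_bad_grid_points K W v.
exists (Badv :|: Bad)%SET; split.
  rewrite /= mulSn; apply: leq_trans (leq_add cv cB).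
  by rewrite -mulnDr leq_mul2l cardsU leq_subr orbT.
move=> f tape; rewrite inE negb_or => /andP[fv fB] ftape u.
by rewrite inE => /predU1P[->|uvs]; [exact: hv ftape | exact: hB ftape _ uvs].
Qed.

Definition grid_tape (f : {ffun 'I_K -> {ffun 'I_d -> 'I_W}}) (t : nat) : nat :=
  if (insub (t %/ d)%N, insub (t %% d)%N) is (Some r, Some j) then f r j else 0%N.

Lemma grid_tapeE f (r : 'I_K) (j : 'I_d) : grid_tape f (r * d + j) = f r j.
Proof.
have d0 : (0 < d)%N by apply: leq_ltn_trans (ltn_ord j).
rewrite /grid_tape divnMDl // divn_small // addn0 modnMDl modn_small //.
have -> : (insub (r : nat) : option 'I_K) = Some r := valK r.
by have -> : (insub (j : nat) : option 'I_d) = Some j := valK j.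
Qed.

Lemma tape_index_lt (r : 'I_K) (j : 'I_d) : (r * d + j < K * d)%N.
Proof.
by have := ltn_ord r; have := ltn_ord j; nia.
Qed.

(** The measurable witness is the finite union of the cell events of the grid tapes outside [Bad];
    its probability is 1 minus the proportion of bad grid points. *)
Lemma prob_good_tape {disp : measure_display} {T : measurableType disp}
    (P : probability T R) (U : nat -> {RV P >-> R}) (vs : seq 'rV[R]_d) :
  iid_uniform01 U -> (0 < W)%N ->
  prob_at_least P (1 - (size vs)%:R * ((4 * d + 1)%:R / W%:R) ^+ K)
    (fun w => good_tape (fun t => U t w) vs).
Proof.
move=> iidU W0; have [Bad [cB hB]] := few_bad_grid_points_seq vs.
have W0' : 0 < W%:R :> R by rewrite ltr0n.
exists (\bigcup_(f in [set` enum (~: Bad)%SET]) cell_event U W (K * d) (grid_tape f)).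
split.
- apply: fin_bigcup_measurable => [|f _]; first exact: finite_seq.
  exact: measurable_cell_event.
- rewrite prob_cell_events //; last 2 first.
  + move=> f t; rewrite /grid_tape.
    by case: insub => [r|] //; case: insub => [j|].
  + move=> f f' ff'; apply/ffunP => r; apply/ffunP => j; apply: val_inj.
    by have := ff' _ (tape_index_lt r j); rewrite !grid_tapeE.
  rewrite lee_fin.
  have cG : (#|~: Bad| + #|Bad| = (W ^ d) ^ K)%N.
    by rewrite addnC cardsC !card_ffun !card_ord.
  have -> : #|(~: Bad)%SET|%:R = ((W ^ d) ^ K)%:R - #|Bad|%:R :> R.
    by rewrite -cG natrD addrK.
  have e1 : ((W ^ d) ^ K)%:R * W%:R^-1 ^+ (K * d) = 1 :> R.
    by rewrite -expnM [(d * K)%N]mulnC natrX -exprMn mulfV ?expr1n // gt_eqF.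
  rewrite mulrBl e1 lerD2l lerN2 exprVn ler_pdivrMr ?exprn_gt0 //.
  rewrite expr_div_n -(ler_pM2l (exprn_gt0 K W0')) -!natrX -natrM.
  have -> : (W ^ K)%:R * ((size vs)%:R * (((4 * d + 1) ^ K)%:R / (W ^ K)%:R) * (W ^ (K * d))%:R)
     = (size vs * ((4 * d + 1) ^ K * (W ^ d) ^ K))%:R :> R.
    rewrite -expnM [(d * K)%N]mulnC !natrM; field.
    by rewrite pnatr_eq0 expn_eq0 negb_and -lt0n W0.
  by rewrite ler_nat.
move=> w [f]; rewrite /= mem_enum inE => fB wf.
have wc r j : cell W (f r j) (U (r * d + j)%N w).
  rewrite -grid_tapeE; apply: wf; rewrite /= mem_iota; exact: tape_index_lt.
split; last by move=> v; apply: hB fB _ v => r j; exact: cellP.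
move=> r j; have /andP[h1 h2] := cellP W0 (wc r j); apply/andP; split.
  by rewrite -(pmulr_rge0 _ W0'); exact: le_trans h1.
rewrite -(ler_pM2l W0') mulr1; apply: ltW (lt_le_trans h2 _).
by rewrite ler_nat.
Qed.

End GoodTape.

(** * From good tapes to accurate answers *)

Section Accuracy.
Context {R : realType} {n d : nat} (tape : nat -> R) (K W : nat).
Implicit Types u v : 'rV[R]_d.

Lemma row_dotN r v : row_dot tape r (- v) = - row_dot tape r v.
Proof. by rewrite /row_dot -sumrN; apply: eq_bigr => j _; rewrite mxE mulrN. Qed.

Lemma sketch_normC u v : sketch_norm tape K (u - v) = sketch_norm tape K (v - u).
Proof. by apply: eq_bigr => r _; rewrite -opprB row_dotN normrN. Qed.

Lemma sketch_norm_triangle u v w :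
  sketch_norm tape K (u - w) <= sketch_norm tape K (u - v) + sketch_norm tape K (v - w).
Proof.
rewrite -big_split; apply: ler_sum => r _ /=; rewrite !row_dotB.
by rewrite -(subrKA (row_dot tape r v)) ler_normD.
Qed.

Lemma sketch_norm_le v :
  (forall (r : 'I_K) (j : 'I_d), 0 <= tape (r * d + j)%N <= 1) ->
  sketch_norm tape K v <= (K * d)%:R * l2norm v.
Proof.
move=> h; rewrite /sketch_norm natrM -mulrA.
apply: (@le_trans _ _ (\sum_(r < K) d%:R * l2norm v)); last first.
  by rewrite sumr_const card_ord -[X in X <= _]mulr_natl.
apply: ler_sum => r _; apply: (le_trans (ler_norm_sum _ _ _)).
apply: (@le_trans _ _ (\sum_(j < d) l2norm v)); last first.
  by rewrite sumr_const card_ord -[X in X <= _]mulr_natl.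
apply: ler_sum => j _; have /andP[h0 h1] := h r j.
by rewrite normrM ger0_norm // (le_trans _ (coord_le_l2norm v j)) // ler_piMl.
Qed.

Definition differences (X : 'M[R]_(n, d)) : seq 'rV[R]_d :=
  [seq row i X - row l X | i <- enum 'I_n, l <- enum 'I_n].

Lemma query_result_accurate X (q : 'rV[R]_d) (u : 'rV[R]_n) vs alpha b :
  good_tape K W tape vs -> {subset differences X <= vs} ->
  1 + (4 * (K * d) * W)%:R <= alpha ->
  query_result tape K W%:R X q u ->
  accurate alpha (QueryReply b X q u).
Proof.
move=> [h01 hvs] sub ha [p [pmin ue]] i.
have near : l2norm (row p X - row i X) <= W%:R * sketch_norm tape K (row p X - row i X).
  by apply/hvs/sub/allpairs_f; rewrite mem_enum.
have S1 : sketch_norm tape K (row i X - q) <= (K * d)%:R * l2norm (q - row i X).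
  by rewrite sketch_normC sketch_norm_le.
have S2 : sketch_norm tape K (row p X - row i X) <= 2 * ((K * d)%:R * l2norm (q - row i X)).
  apply: le_trans (sketch_norm_triangle _ q _) _.
  by have := pmin i; have := sketch_normC q (row i X); lra.
rewrite ue; apply/andP; split.
  rewrite (_ : q - row i X = (q - row p X) + (row p X - row i X)); last by rewrite addrA subrK.
  by apply: le_trans (l2normD _ _) _; rewrite lerD2l.
(* By [near] the term W * [sketch_norm] now bounds the last summand too, so it enters the answer
   twice; with the factor 2 of [S2] this gives 4 K d W. *)
have r1 : l2norm (q - row p X) <= l2norm (q - row i X) + l2norm (row p X - row i X).
  rewrite -(l2normN (row p X - row i X)) opprB.
  by rewrite (_ : q - row p X = (q - row i X) + (row i X - row p X)) ?l2normD // addrA subrK.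
apply: le_trans (ler_wpM2r (l2norm_ge0 _) ha).
have S3 : W%:R * sketch_norm tape K (row p X - row i X)
   <= W%:R * (2 * ((K * d)%:R * l2norm (q - row i X))) by rewrite ler_wpM2l.
rewrite mulrDl mul1r !natrM; rewrite natrM in S3; lra.
Qed.

End Accuracy.

(** * Choice of the scale and time bounds *)

(** One natural constant replaces both constants of the Theta bound, so that later estimates can
    stay in the naturals. *)
Lemma Theta_nat_bounds (R : realType) (f : nat -> nat) (g : nat -> R) :
  (forall n, 0 <= g n) ->
  (fun n => (f n)%:R : R^o) \is 'Theta_\oo (fun n => g n : R^o) ->
  exists2 a : nat, (0 < a)%N &
    \forall n \near \oo, (f n)%:R <= a%:R * g n /\ g n <= a%:R * (f n)%:R.
Proof.
move=> g0; rewrite qualifE => /asboolP[[k1 k2] /= /andP[k10 k20] H].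
pose a := (Num.bound k1^-1 + Num.bound k2)%N.
have k1a : k1^-1 <= a%:R.
  apply: ltW; apply: lt_le_trans (archi_boundP _) _; first by rewrite invr_ge0 ltW.
  by rewrite ler_nat leq_addr.
have k2a : k2 <= a%:R.
  apply: ltW; apply: lt_le_trans (archi_boundP _) _; first exact: ltW.
  by rewrite ler_nat leq_addl.
exists a; first by rewrite -(ltr_nat R); exact: lt_le_trans k2a.
apply: filterS H => n [h1 h2].
rewrite !normr_nat ger0_norm ?g0 // in h1 h2; split.
  by apply: (le_trans h2); rewrite ler_wpM2r.
rewrite -ler_pdivlMl // in h1; apply: (le_trans h1).
by rewrite ler_wpM2r.
Qed.

(** Both bounds are ln (1 + x) <= x, at x = 1 and at x = -1/2. *)
Lemma ln2_bounds (R : realType) : 2^-1 <= ln (2 : R) <= 1.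
Proof.
apply/andP; split; last by have := @le_ln1Dx R 1; rewrite -[1 + 1]/(2); apply; lra.
have := @le_ln1Dx R (- 2^-1); rewrite (_ : 1 + - 2^-1 = 2^-1); last by field.
by rewrite lnV ?posrE //; lra.
Qed.

Lemma ln_pow2 (R : realType) m : ln (2 ^ m)%:R = m%:R * ln 2 :> R.
Proof. by rewrite natrX lnXn // mulr_natl. Qed.

Lemma ln_ge1 (R : realType) n : (4 <= n)%N -> 1 <= ln n%:R :> R.
Proof.
move=> n4; have : ln (2 ^ 2)%:R <= ln n%:R :> R.
  by rewrite ler_ln ?posrE ?ltr0n ?ler_nat //; lia.
by rewrite ln_pow2; have /andP[] := ln2_bounds R; lra.
Qed.

Lemma ln_le_nat (R : realType) n : (0 < n)%N -> ln n%:R <= n%:R :> R.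
Proof.
move=> n0; have := @le_ln1Dx R (n%:R - 1); rewrite addrCA subrr addr0.
have : 0 < n%:R :> R by rewrite ltr0n.
by move=> n0' /(_ ltac:(lra)); lra.
Qed.

Section Exponent.
Context {R : realType} (n K : nat).
Hypotheses (n4 : (4 <= n)%N) (nK : (n <= 2 ^ (K ^ 2))%N).

Let L : R := ln n%:R.

Lemma exponent_gt0 : (0 < K)%N.
Proof. by case: (K) nK; [rewrite expn0; lia|]. Qed.

Lemma ln_le_exponent_sqr : L <= (K ^ 2)%:R.
Proof.
have : L <= ln (2 ^ (K ^ 2))%:R.
  by rewrite ler_ln ?posrE ?ltr0n ?ler_nat ?expn_gt0 //; lia.
rewrite ln_pow2 => /le_trans; apply.
by rewrite ler_piMr //; have /andP[] := ln2_bounds R.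
Qed.

Hypothesis Kn : forall m, (m < K)%N -> (2 ^ (m ^ 2) < n)%N.

(** Minimality at K - 1 gives (K - 1) ^ 2 * ln 2 <= L, so K - 1 is at most twice the root of L; that
    root is at least 1 and absorbs the missing 1. *)
Lemma exponent_le_sqrt_ln : K%:R <= 3 * Num.sqrt L.
Proof.
have L1 : 1 <= L := ln_ge1 R n4.
have s1 : 1 <= Num.sqrt L by rewrite -[leLHS]sqrtr1 ler_wsqrtr.
have ss : Num.sqrt L ^+ 2 = L by rewrite sqr_sqrtr; lra.
have Kn' : (2 ^ (K.-1 ^ 2) < n)%N by apply: Kn; rewrite ltn_predL exponent_gt0.
have : ln (2 ^ (K.-1 ^ 2))%:R <= L.
  by rewrite ler_ln ?posrE ?ltr0n ?ler_nat ?expn_gt0 ?(ltnW Kn') //; lia.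
rewrite ln_pow2 natrX => h.
have : K.-1%:R <= 2 * Num.sqrt L.
  have s2 : 0 <= 2 * Num.sqrt L by lra.
  rewrite -(ler_pXn2r (n := 2)) ?nnegrE ?ler0n //.
  rewrite exprMn ss; have /andP[l2 _] := ln2_bounds R.
  have : (K.-1%:R ^+ 2) * 2^-1 <= K.-1%:R ^+ 2 * ln 2 :> R by rewrite ler_wpM2l ?sqr_ge0.
  lra.
have -> : K%:R = K.-1%:R + 1 :> R by rewrite natr1 prednK // exponent_gt0.
lra.
Qed.

Lemma exponent_le_mul a k : Num.sqrt L <= a%:R * k%:R -> (K <= 3 * a * k)%N.
Proof.
move=> h; rewrite -(ler_nat R) !natrM; have := exponent_le_sqrt_ln; lra.
Qed.

(** As E <= exp E, the left side is at most exp (E K), and k K <= 3 a L turns E K into at most (C /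
    k) L. *)
Lemma ratio_le_powR a k (E C : nat) : (0 < a)%N -> (0 < k)%N ->
  k%:R <= a%:R * Num.sqrt L -> (3 * a * E <= C)%N ->
  E%:R ^+ K <= n%:R `^ (C%:R / k%:R) :> R.
Proof.
move=> a0 k0 ka EC; have L1 : 1 <= L := ln_ge1 R n4.
have ss : Num.sqrt L * Num.sqrt L = L by rewrite -expr2 sqr_sqrtr; lra.
have a0' : 0 < a%:R :> R by rewrite ltr0n.
have k0' : 0 < k%:R :> R by rewrite ltr0n.
rewrite /powR pnatr_eq0 -/L; have -> : (n == 0)%N = false by lia.
have kK : k%:R * K%:R <= 3 * a%:R * L.
  rewrite -ss (_ : 3 * a%:R * _ = a%:R * Num.sqrt L * (3 * Num.sqrt L)); last by ring.
  by apply: ler_pM => //; exact: exponent_le_sqrt_ln.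
have EK : E%:R * K%:R <= C%:R / k%:R * L.
  rewrite mulrAC ler_pdivlMr //.
  apply: (@le_trans _ _ ((3 * a * E)%:R * L)); last first.
    by rewrite ler_wpM2r ?ler_nat //; lra.
  rewrite !natrM (_ : E%:R * K%:R * k%:R = E%:R * (k%:R * K%:R)); last by ring.
  by rewrite mulrAC [X in _ <= X]mulrC ler_wpM2l.
apply: le_trans (_ : expR (E%:R * K%:R) <= _); last by rewrite ler_expR.
rewrite expRM_natr lerXn2r ?nnegrE ?expR_ge0 //.
by apply: le_trans (expR_ge1Dx _); rewrite lerDr.
Qed.

End Exponent.

Lemma exists_exponent n : exists K, (n <= 2 ^ (K ^ 2))%N /\
  forall m, (m < K)%N -> (2 ^ (m ^ 2) < n)%N.
Proof.
have ex : exists K, (n <= 2 ^ (K ^ 2))%N.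
  exists n; apply: leq_trans (ltnW (ltn_expl n (isT : (1 < 2)%N))) _.
  by rewrite leq_pexp2l // -mulnn; case: n => // m; rewrite leq_pmulr.
exists (ex_minn ex); case: ex_minnP => K hK Kmin; split=> // m mK.
by rewrite ltnNge; apply: contraL mK => /Kmin; rewrite -leqNgt.
Qed.

(** * Step counts against the time budgets *)

Section Budgets.
Context (n d K k a : nat).
Hypotheses (d0 : (0 < d)%N) (K0 : (0 < K)%N) (Kk : (K <= 3 * a * k)%N).

Lemma update_steps_le : (d * 4 + 2 + (K * (d * 6 + 6) + 2) <= 60 * a * (d * k))%N.
Proof.
apply: (@leq_trans (20 * (d * K))%N); last first.
  by rewrite (_ : 60 * a * (d * k) = 20 * (d * (3 * a * k)))%N ?leq_mul //; ring.
by nia.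
Qed.

Hypothesis n0 : (0 < n)%N.

Lemma init_steps_le : (init_steps n d K <= 123 * a * (n * d * k))%N.
Proof.
apply: (@leq_trans (41 * (n * d * K))%N); last first.
  by rewrite (_ : 123 * a * (n * d * k) = 41 * (n * d * (3 * a * k)))%N ?leq_mul //; ring.
rewrite /init_steps.
have h1 : (K <= n * d * K)%N by rewrite leq_pmull // muln_gt0 n0.
have h2 : (K * d <= n * d * K)%N by nia.
have h3 : (n * K <= n * d * K)%N by nia.
have h4 : (n <= n * K)%N by nia.
have -> : (n * (K * (d * 6 + 6) + 4) = 6 * (n * d * K) + 6 * (n * K) + 4 * n)%N by ring.
by lia.
Qed.

Lemma query_steps_le : (d <= a * n)%N ->
  (query_steps n d K <= 3 * a * (32 * a + 54) * (n * k))%N.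
Proof.
move=> da; apply: (@leq_trans ((32 * a + 54) * (n * K))%N); last first.
  rewrite (_ : 3 * a * (32 * a + 54) * (n * k) = (32 * a + 54) * (n * (3 * a * k)))%N ?leq_mul //.
  by ring.
rewrite /query_steps.
have h1 : (d * K <= a * (n * K))%N by rewrite mulnA leq_mul.
have h2 : (d <= d * K)%N by nia.
have h3 : (n <= n * K)%N by nia.
have h4 : (K <= d * K)%N by nia.
have -> : (K * (d * 6 + 6) = 6 * (d * K) + 6 * K)%N by ring.
have -> : (n * (16 * K + 12) = 16 * (n * K) + 12 * n)%N by ring.
have -> : (n * (8 * K + 8) = 8 * (n * K) + 8 * n)%N by ring.
rewrite mulnDl -mulnA; lia.
Qed.

End Budgets.

Section ScaleChoice.
Context (R : realType) (n d K a c : nat).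
Hypotheses (a0 : (0 < a)%N) (K0 : (0 < K)%N) (dK : (d <= a * K ^ 2)%N).

(** In B ^ K the factor (20 a) ^ K outweighs 4 d + 1, because d <= a K ^ 2 <= a 4 ^ K; the other
    factor, raised to K once more, is at least n ^ (2 c + 3). *)
Let B := (20 * a * 2 ^ (2 * c + 3))%N.

Lemma base_gt0 : (0 < B)%N.
Proof. by rewrite /B !muln_gt0 a0 expn_gt0. Qed.

Lemma leq_exp_self x : (x <= x ^ K)%N.
Proof. by case: (K) K0 => // K' _; case: x => // x; rewrite expnS leq_pmulr // expn_gt0. Qed.

(** The polynomial factor is at most 5 a K ^ 3, and K <= 2 ^ K bounds it by (5 a * 8) ^ K. *)
Lemma distortion_le : (1 + 4 * (K * d) * B ^ K <= (40 * a * B) ^ K)%N.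
Proof.
have B0 := base_gt0.
have K2 : (K <= 2 ^ K)%N by apply: ltnW; exact: ltn_expl.
apply: (@leq_trans (5 * a * K ^ 3 * B ^ K)%N).
  have BK : (0 < B ^ K)%N by rewrite expn_gt0 B0.
  have h : (K * d <= a * K ^ 3)%N.
    by rewrite (_ : a * K ^ 3 = K * (a * K ^ 2))%N ?leq_mul //; ring.
  have h1 : (1 <= a * K ^ 3 * B ^ K)%N by rewrite !muln_gt0 a0 BK ?expn_gt0 K0.
  have h2 : (K * d * B ^ K <= a * K ^ 3 * B ^ K)%N by rewrite leq_mul.
  by rewrite -!mulnA in h1 h2 *; lia.
rewrite expnMn leq_mul // (_ : 40 * a = 5 * a * 2 ^ 3)%N; last by lia.
by rewrite expnMn leq_mul ?leq_exp_self // expnAC leq_exp2r.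
Qed.

Hypotheses (d0 : (0 < d)%N) (n1 : (1 < n)%N) (nK : (n <= 2 ^ (K ^ 2))%N).

Lemma failure_ratio_le : ((4 * d + 1)%:R / (B ^ K)%:R) ^+ K <= n%:R ^- (2 * c + 3) :> R.
Proof.
have B0 := base_gt0.
have K2 : (K <= 2 ^ K)%N by apply: ltnW; exact: ltn_expl.
have h5 : (4 * d + 1 <= (20 * a) ^ K)%N.
  apply: (@leq_trans (5 * a * (2 ^ K * 2 ^ K))%N).
    apply: (@leq_trans (5 * (a * K ^ 2))%N); first by lia.
    by rewrite -mulnA !leq_mul // -mulnn leq_mul.
  rewrite -expnMn (_ : 20 * a = 5 * a * (2 * 2))%N; last by lia.
  by rewrite [in leqRHS]expnMn leq_mul2r leq_exp_self orbT.
have BE : (B ^ K = (20 * a) ^ K * 2 ^ ((2 * c + 3) * K))%N by rewrite /B expnMn -expnM.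
have r1 : (4 * d + 1)%:R / (B ^ K)%:R <= (2 ^ ((2 * c + 3) * K))%:R ^-1 :> R.
  rewrite ler_pdivrMr ?ltr0n ?expn_gt0 ?B0 // BE natrM mulrC mulfK.
    by rewrite ler_nat.
  by rewrite pnatr_eq0 expn_eq0.
apply: le_trans (_ : ((2 ^ ((2 * c + 3) * K))%:R ^-1) ^+ K <= _).
  by rewrite lerXn2r // ?nnegrE ?divr_ge0 // ?invr_ge0 ?ler0n.
rewrite exprVn -natrX -natrX lef_pV2 ?posrE ?ltr0n ?expn_gt0 //; last by rewrite (ltn_trans _ n1).
rewrite ler_nat -expnM (_ : (2 * c + 3) * K * K = K ^ 2 * (2 * c + 3))%N; last by rewrite -mulnn; ring.
by rewrite expnM leq_exp2r // addn3.
Qed.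

(** With p data sets of n ^ 2 differences each there are at most n ^ (c + 3) vectors, each failing
    with probability at most n ^ (- (2 c + 3)). *)
Lemma union_bound_le p : (p <= n ^ c + 1)%N ->
  1 - n%:R ^- c <=
  1 - (p * (n * n))%:R * ((4 * d + 1)%:R / (B ^ K)%:R) ^+ K :> R.
Proof.
move=> pn; rewrite lerD2l lerN2.
have n0 : 0 < n%:R :> R by rewrite ltr0n (ltn_trans _ n1).
apply: (@le_trans _ _ ((n ^ (c + 3))%:R * n%:R ^- (2 * c + 3))); last first.
  rewrite natrX (_ : 2 * c + 3 = c + (c + 3))%N; last by lia.
  by rewrite [n%:R ^+ (c + (c + 3))]exprD invfM mulrCA mulfV ?mulr1 // gt_eqF ?exprn_gt0.
apply: ler_pM => //; last exact: failure_ratio_le.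
rewrite ler_nat addn3 !expnSr -!mulnA [(n ^ c * _)%N]mulnA leq_mul //.
have : (0 < n ^ c)%N by rewrite expn_gt0 (ltn_trans _ n1).
by nia.
Qed.

End ScaleChoice.

Lemma size_all_differences (R : realType) n d (Xs : seq 'M[R]_(n, d)) :
  size (flatten (map differences Xs)) = (size Xs * (n * n))%N.
Proof.
elim: Xs => //= X Xs IH.
by rewrite size_cat IH size_allpairs -cardT card_ord mulSn.
Qed.

Lemma differences_sub (R : realType) n d (X : 'M[R]_(n, d)) Xs : X \in Xs ->
  {subset differences X <= flatten (map differences Xs)}.
Proof. by move=> XXs v vX; apply/flattenP; exists (differences X) => //; exact: map_f. Qed.

Lemma prob_at_least_mono (disp : measure_display) (T : measurableType disp)
    (R : realType) (P : probability T R) (p p' : R) (E E' : T -> Prop) :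
  prob_at_least P p E -> p' <= p -> (forall w, E w -> E' w) -> prob_at_least P p' E'.
Proof.
move=> [A [mA PA AE]] pp EE; exists A; split=> //.
  by apply: le_trans PA; rewrite lee_fin.
by move=> w /AE /EE.
Qed.

Lemma ln_nat_ge0 (R : realType) n : 0 <= ln n%:R :> R.
Proof.
by case: n => [|n]; [rewrite ln0 | rewrite ln_ge0 // ler1n].
Qed.

Theorem theorem7p2 (R : realType) (d k : nat -> nat)
  (hd : (fun n => (d n)%:R : R^o) \is 'Theta_\oo (fun n => ln n%:R : R^o))
  (hk : (fun n => (k n)%:R : R^o) \is
          'Theta_\oo (fun n => Num.sqrt (ln n%:R) : R^o))
  (c : nat) :
  exists (D : data_structure) (C : nat), \forall n \near \oo,
  forall (disp : measure_display) (T : measurableType disp)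
    (P : probability T R) (U : nat -> {RV P >-> R}), iid_uniform01 U ->
  forall (eps : R), 0 < eps < 1 ->
  forall (X : 'M[R]_(n, d n)) (reqs : seq (request R n (d n)))
    (adversary : seq 'rV[R]_n -> 'rV[R]_(d n)),
  let tape w t := U t w in
  let started w := run (tape w) (C * (n * d n * k n)) (init D)
                     (init_state X eps) in
  let replies w := serve D (C * (d n * k n)) (C * (n * k n)) (tape w)
                     adversary reqs (started w).2 X [::] in
  let accurate_at j w := forall r, onth (replies w) j = Some r ->
        accurate (n%:R `^ (C%:R / (k n)%:R)) r in
  [/\ forall w, halted (started w) && all served_in_time (replies w),
      forall j, prob_at_least P (1 - n%:R ^- c) (accurate_at j)
    & (count is_update reqs <= n ^ c)%N ->
      prob_at_least P (1 - n%:R ^- c) (fun w => forall j, accurate_at j w)].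
Proof.
have [a1 a10 H1] := Theta_nat_bounds (@ln_nat_ge0 R) hd.
have [a2 a20 H2] := Theta_nat_bounds (fun n => sqrtr_ge0 (ln n%:R)) hk.
pose a := (a1 + a2)%N.
have a0 : (0 < a)%N by rewrite addn_gt0 a10.
have a1a : a1%:R <= a%:R :> R by rewrite ler_nat leq_addr.
have a2a : a2%:R <= a%:R :> R by rewrite ler_nat leq_addl.
pose B := (20 * a * 2 ^ (2 * c + 3))%N.
(* The summands serve the approximation exponent and the budgets of initialisation, update and
   query, in this order. *)
pose C := (3 * a * (40 * a * B) + 123 * a + 60 * a + 3 * a * (32 * a + 54))%N.
exists (sketching B), C.
have H3 := nbhs_infty_ge 4.
near=> n.
have n4 : (4 <= n)%N by near: n.
have [dle dge] : (d n)%:R <= a1%:R * ln n%:R :> R /\ ln n%:R <= a1%:R * (d n)%:R :> R.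
  by near: n.
have [kle kge] : (k n)%:R <= a2%:R * Num.sqrt (ln n%:R) :> R /\
    Num.sqrt (ln n%:R) <= a2%:R * (k n)%:R :> R by near: n.
have L1 : 1 <= ln n%:R :> R := ln_ge1 R n4.
have s0 := sqrtr_ge0 (ln n%:R : R).
have {}dle : (d n)%:R <= a%:R * ln n%:R :> R.
  by apply: (le_trans dle); rewrite ler_wpM2r //; lra.
have d0 : (0 < d n)%N.
  by rewrite lt0n; apply: contraTneq L1 => d0; move: dge; rewrite d0 mulr0; lra.
have k0 : (0 < k n)%N.
  rewrite lt0n; apply: contraTneq L1 => k0; move: kge; rewrite k0 mulr0 => h.
  have : Num.sqrt (ln n%:R) == 0 :> R by rewrite eq_le h s0.
  by rewrite sqrtr_eq0 => h'; rewrite -ltNge; lra.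
have {}kle : (k n)%:R <= a%:R * Num.sqrt (ln n%:R) :> R.
  by apply: (le_trans kle); rewrite ler_wpM2r.
have {}kge : Num.sqrt (ln n%:R) <= a%:R * (k n)%:R :> R.
  by apply: (le_trans kge); rewrite ler_wpM2r.
have [K [nK Kn]] := exists_exponent n.
have K0 := exponent_gt0 n4 nK.
have Kk : (K <= 3 * a * k n)%N := exponent_le_mul n4 nK Kn kge.
have dK : (d n <= a * K ^ 2)%N.
  rewrite -(ler_nat R) natrM; apply: (le_trans dle).
  by rewrite ler_wpM2l //; exact: ln_le_exponent_sqr.
have dn : (d n <= a * n)%N.
  rewrite -(ler_nat R) natrM; apply: (le_trans dle).
  by rewrite ler_wpM2l // ln_le_nat; lia.
have n1 : (1 < n)%N by lia.
have n0 : (0 < n)%N by lia.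
have tI : (init_steps n (d n) K <= C * (n * d n * k n))%N.
  by apply: leq_trans (init_steps_le d0 K0 Kk n0) _; rewrite leq_mul2r /C; lia.
have tU : (d n * 4 + 2 + (K * (d n * 6 + 6) + 2) <= C * (d n * k n))%N.
  by apply: leq_trans (update_steps_le d0 K0 Kk) _; rewrite leq_mul2r /C; lia.
have tQ : (query_steps n (d n) K <= C * (n * k n))%N.
  by apply: leq_trans (query_steps_le d0 K0 Kk n0 dn) _; rewrite leq_mul2r /C; lia.
have B0 : (0 < B ^ K)%N by rewrite expn_gt0 base_gt0.
move=> disp T P U iidU eps _ X reqs adversary.
pose tape w t := U t w.
pose started w := run (tape w) (C * (n * d n * k n)) (init (sketching B))
  (init_state X eps).
pose replies w := serve (sketching B) (C * (d n * k n)) (C * (n * k n)) (tape w)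
  adversary reqs (started w).2 X [::].
pose accurate_at j w := forall r, onth (replies w) j = Some r ->
  accurate (n%:R `^ (C%:R / (k n)%:R)) r.
have serve_ok w : halted (started w) /\ (all served_in_time (replies w) /\
  forall j r, onth (replies w) j = Some r ->
    if r is QueryReply _ Y q u
    then Y = points_after X (take j reqs) /\
         query_result (tape w) K (B ^ K)%:R Y q u
    else True).
  have [h1 h2] := wp_run (wp_weaken tI (init_spec (tape w) B X eps nK Kn)).
  by split=> //; rewrite natrX; exact: serve_spec.
have alpha_ge : 1 + (4 * (K * d n) * B ^ K)%:R <= n%:R `^ (C%:R / (k n)%:R) :> R.
  apply: le_trans (_ : ((40 * a * B) ^ K)%:R <= _).
    by rewrite -[1]/(1%:R) -natrD ler_nat; exact: distortion_le.
  rewrite natrX; apply: ratio_le_powR kle _ => //; rewrite /C; lia.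
(* Goodness concerns only differences of data points, so a good tape withstands every adaptive
   choice of queries. *)
have ok (Xs : seq 'M[R]_(n, d n)) w :
    good_tape K (B ^ K) (tape w) (flatten (map differences Xs)) ->
    forall j, points_after X (take j reqs) \in Xs -> accurate_at j w.
  move=> good j jXs r rj; have [_ [_ /(_ j r rj)]] := serve_ok w.
  case: r {rj} => // b Y q u [-> res].
  exact: (query_result_accurate b good (differences_sub jXs) alpha_ge res).
split.
- by move=> w; have [-> [-> _]] := serve_ok w.
(* A single reply involves one data set, fixed by the schedule, so the number of updates is
   irrelevant here. *)
- move=> j; apply: prob_at_least_mono (prob_good_tape K
    (flatten (map differences [:: points_after X (take j reqs)])) iidU B0) _ _.
    by rewrite size_all_differences; apply: union_bound_le; rewrite //= leq_addl.
  by move=> w /ok; apply; rewrite mem_head.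
(* For all replies at once, the at most n ^ c + 1 versions must be good simultaneously. *)
move=> few; apply: prob_at_least_mono (prob_good_tape K
    (flatten (map differences (versions X reqs))) iidU B0) _ _.
  rewrite size_all_differences; apply: union_bound_le => //.
  by rewrite size_versions addn1 ltnS.
move=> w /ok h j; apply: h; exact: points_after_versions.
Unshelve. all: by end_near.
Qed.
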